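(* (i) Let $U$ be the solution of the exterior Dirichlet problem described in the context, with $\partial\Omega$ a smooth convex surface. If some equipotential surface of $U$ is a sphere, then $\partial\Omega$ is a sphere. (ii) Let $G$ be the Green's function of the interior Dirichlet problem described in the context, with $\partial\Omega$ a smooth convex surface. If there is an equipotential surface of $G$ on which $|\nabla G(\boldsymbol r)|$ is constant, then $\partial\Omega$ is a sphere centered at the origin.
   Context: $\Omega\subset\mathbb R^3$ is an unbounded domain whose boundary $\partial\Omega$ is a smooth, connected, compact surface (so $\mathbb R^3\smallsetminus\Omega$ is bounded). Convexity of $\partial\Omega$ means that it is the boundary of a bounded convex body $\mathbb R^3\smallsetminus\Omega$ (Gaussian curvature $K\ge 0$ on $\partial\Omega$). Exterior Dirichlet problem: $U$ is a non-constant harmonic function in $\Omega$, smooth up to $\partial\Omega$, constant on $\partial\Omega$, with flux $-\oint_{\partial\Omega}\boldsymbol n\cdot\nabla U\,\mathrm dS=\Phi>0$, where $\boldsymbol n$ is the unit normal on $\partial\Omega$ pointing into $\Omega$, and with $U(\boldsymbol r)\sim\frac{\Phi}{4\pi|\boldsymbol r|}$ as $|\boldsymbol r|\to+\infty$. Interior Dirichlet problem: assume $\mathbf 0\notin\Omega\cup\partial\Omega$. $G$ is the Dirichlet Green's function of $\mathbb R^3\smallsetminus(\Omega\cup\partial\Omega)$ with pole at $\mathbf 0$: $G$ is harmonic in $\mathbb R^3\smallsetminus(\Omega\cup\partial\Omega\cup\{\mathbf 0\})$, $G=0$ on $\partial\Omega$, and $-\lim_{\varepsilon\to0^+}\oint_{|\boldsymbol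 r|=\varepsilon}\boldsymbol n\cdot\nabla G\,\mathrm dS=1$ with $\boldsymbol n$ the outward unit normal of the sphere $|\boldsymbol r|=\varepsilon$ (so $G$ has the singularity $\frac1{4\pi|\boldsymbol r|}$ at $\mathbf 0$). An equipotential surface is a level set of $U$ in $\Omega\cup\partial\Omega$ (respectively of $G$ in $\mathbb R^3\smallsetminus(\Omega\cup\{\mathbf 0\})$). *)

(* Defs.v *)
From HB Require Import structures.
From mathcomp Require Import all_boot all_order all_algebra.
From mathcomp Require Import all_classical all_reals all_analysis.

Set Implicit Arguments.
Unset Strict Implicit.
Unset Printing Implicit Defensive.

Import Order.TTheory GRing.Theory Num.Theory.
Import numFieldNormedType.Exports.

Local Open Scope classical_set_scope.
Local Open Scope ring_scope.

(* The norm [`|x|] of the library on row vectors is the sup norm, hence a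
   separate Euclidean norm; both induce the topology used below. *)
Definition dot (R : realType) (u v : 'rV[R]_3) : R :=
  \sum_(i < 3) u 0 i * v 0 i.

Definition enorm (R : realType) (u : 'rV[R]_3) : R := Num.sqrt (dot u u).

Definition sphere (R : realType) (a : 'rV[R]_3) (r : R) : set 'rV[R]_3 :=
  [set x | enorm (x - a) = r].

(* The filter |x| --> +oo. *)
Definition enorm_infty (R : realType) : set_system 'rV[R]_3 :=
  filter_from setT (fun M : R => [set x | M < enorm x]).

Definition bdry (T : topologicalType) (A : set T) : set T :=
  closure A `\` interior A.

Section calculus.
Variable R : realType.
Implicit Types (A : set 'rV[R]_3) (f : 'rV[R]_3 -> R) (x p : 'rV[R]_3).

Definition partial (i : 'I_3) f : 'rV[R]_3 -> R := 'D_(delta_mx 0 i) f.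

Definition partials (s : seq 'I_3) f : 'rV[R]_3 -> R := foldr partial f s.

Definition grad f x : 'rV[R]_3 := \row_i partial i f x.

Definition laplacian f x : R := \sum_(i < 3) partials [:: i; i] f x.

(* A is meant to be open. *)
Definition Ck_on (k : nat) A f : Prop := forall x, A x ->
  (forall s, (size s <= k)%N -> {for x, continuous (partials s f)}) /\
  (forall s i, (size s < k)%N -> derivable (partials s f) x (delta_mx 0 i)).

Definition smooth_on A f : Prop := forall k, Ck_on k A f.

Definition harmonic_on A f : Prop :=
  Ck_on 2 A f /\ forall x, A x -> laplacian f x = 0.

Definition smooth_up_to_boundary A f : Prop :=
  [/\ smooth_on A f, {within closure A, continuous f} &
      forall s p, closure A p ->
        cvg (partials s f x @[x --> within A (nbhs p)])].

(* Extension by continuity of the gradient to the closure of A. *)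
Definition closure_grad A f p : 'rV[R]_3 :=
  lim (grad f x @[x --> within A (nbhs p)]).

End calculus.

(* Two-dimensional Hausdorff measure, normalised by the factor pi / 4 so that it
   is the area measure on smooth surfaces. *)
Section hausdorff2.
Variable R : realType.
Local Open Scope ereal_scope.
Implicit Types (A : set 'rV[R]_3) (d : R).

(* The added 0 makes the diameter of the empty set 0 instead of -oo. *)
Definition ediam A : \bar R :=
  ereal_sup (0 |` [set (enorm (p.1 - p.2))%:E | p in A `*` A]).

Definition hausdorff2_cover d A : set ((set 'rV[R]_3)^nat) :=
  [set C | (forall k, ediam (C k) <= d%:E) /\ A `<=` \bigcup_k C k].

Definition hausdorff2_pre d A : \bar R :=
  ereal_inf [set \sum_(k <oo) (pi / 4)%:E * (ediam (C k) * ediam (C k))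
            | C in hausdorff2_cover d A].

Definition hausdorff2 A : \bar R :=
  ereal_sup [set hausdorff2_pre d A | d in [set d | (0 < d)%R]].

Lemma ediam_ge0 A : 0 <= ediam A.
Proof. by apply: ereal_sup_ubound; left. Qed.

Lemma ediam0 : ediam set0 = 0.
Proof.
rewrite /ediam (_ : [set _ | p in _] = set0) ?setU0 ?ereal_sup1//.
by apply/seteqP; split=> // x [p [] []].
Qed.

Let w A : \bar R := (pi / 4)%:E * (ediam A * ediam A).

Let w_ge0 A : 0 <= w A.
Proof. by rewrite /w !mule_ge0 ?ediam_ge0// lee_fin divr_ge0// pi_ge0. Qed.

Lemma hausdorff2_pre_ge0 d A : 0 <= hausdorff2_pre d A.
Proof.
apply: le_ereal_inf_tmp => x [B _ <-{x}].
by apply: nneseries_ge0 => k _ _; exact: w_ge0.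
Qed.

Lemma hausdorff2_pre0 d : (0 < d)%R -> hausdorff2_pre d set0 = 0.
Proof.
move=> d0; apply/eqP; rewrite eq_le; apply/andP; split;
  last exact/hausdorff2_pre_ge0.
apply: ereal_inf_lbound; exists (fun=> set0).
  by split=> // k; rewrite ediam0 lee_fin ltW.
by rewrite eseries0// => k _ _; rewrite ediam0 mule0 mule0.
Qed.

Lemma le_hausdorff2_pre d : {homo hausdorff2_pre d : A B / A `<=` B >-> A <= B}.
Proof.
move=> A B AB; apply/ereal_inf_le_tmp => x [C [mC BC] <-{x}].
by exists C => //; split => //; apply: subset_trans AB BC.
Qed.

Lemma hausdorff2_pre_sigma_subadditive d : sigma_subadditive (hausdorff2_pre d).
Proof.
move=> A; have [[i ioo]|] := pselect (exists i, hausdorff2_pre d (A i) = +oo).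
  rewrite (eseries_pinfty _ _ ioo) ?leey// => n _.
  by rewrite -ltNye (lt_le_trans _ (hausdorff2_pre_ge0 _ _)).
rewrite -forallNE => Aoo.
suff add2e (e : {posnum R}) : hausdorff2_pre d (\bigcup_n A n) <=
    \sum_(i <oo) hausdorff2_pre d (A i) + e%:num%:E.
  by apply/lee_addgt0Pr => _/posnumP[].
rewrite (le_trans _ (epsilon_trick _ _ _))//; last first.
  by move=> n; exact: hausdorff2_pre_ge0.
pose P n (B : (set 'rV[R]_3)^nat) := hausdorff2_cover d (A n) B /\
  \sum_(k <oo) w (B k) <= hausdorff2_pre d (A n) + (e%:num / (2 ^ n.+1)%:R)%:E.
have [G PG] : {G : ((set 'rV[R]_3)^nat)^nat & forall n, P n (G n)}.
  apply: (@choice _ _ P) => n; rewrite /P /hausdorff2_pre.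
  set S := (X in ereal_inf X); move infS : (ereal_inf S) => iS.
  case: iS infS => [r Sr|Soo|Soo].
  - have en1 : (0 < e%:num / (2 ^ n.+1)%:R)%R by [].
    have /(lb_ereal_inf_adherent en1) : ereal_inf S \is a fin_num by rewrite Sr.
    move=> [x [B AnB muBx] xS].
    by exists B; split => //; rewrite /w muBx -Sr; exact/ltW.
  - by have := Aoo n; rewrite /hausdorff2_pre Soo.
  - suff : lbound S 0 by move/le_ereal_inf_tmp; rewrite Soo.
    by move=> /= _ [B AnB <-]; apply: nneseries_ge0 => k _ _; exact: w_ge0.
have wG_ge0 x : 0 <= (w \o uncurry G) x by exact: w_ge0.
apply: (@le_trans _ _ (\esum_(i in setT) (w \o uncurry G) i)).
  apply: ereal_inf_lbound => /=.
  have /card_esym/ppcard_eqP[f] := card_nat2.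
  exists (uncurry G \o f).
    split => [i|].
      by rewrite /= /uncurry; case: (f i) => a b; exact: (PG a).1.1.
    apply: (@subset_trans _  (\bigcup_n \bigcup_k G n k)) => [t [i _]|].
      by move=> /(PG i).1.2 -[j _ ?]; exists i => //; exists j.
    move=> t [i _ [j _ Bijt]]; exists (f^-1%FUN (i, j)) => //=.
    by rewrite invK ?inE.
  rewrite -(esum_pred_image (w \o uncurry G) _ xpredT) ?[fun=> _]set_true//.
  by rewrite image_eq.
rewrite (_ : esum _ _ = \sum_(i <oo) \sum_(j <oo ) w (G i j)); last first.
  pose J : nat -> set (nat * nat) := fun i => [set (i, j) | j in setT].
  rewrite (_ : setT = \bigcup_k J k); last first.
    by rewrite predeqE => -[a b]; split => // _; exists a => //; exists b.
  rewrite esum_bigcupT /=; last 2 first.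
    - apply/trivIsetP => i j _ _ ij.
      rewrite predeqE => -[n m] /=; split => //= -[] [_] _ [<-{n} _].
      by move=> [m' _] [] /esym/eqP; rewrite (negbTE ij).
    - by move=> /= [n m]; exact: w_ge0.
  rewrite -(image_id [set: nat]) -fun_true esum_pred_image//; last first.
    by move=> n _; exact: esum_ge0.
  apply: eq_eseriesr => /= j _.
  rewrite -(esum_pred_image (w \o uncurry G) (pair j) predT)//=; last first.
    by move=> ? ? _ _; exact: (@can_inj _ _ _ snd).
  by congr esum; rewrite predeqE => -[a b]; split; move=> [i _ <-]; exists i.
apply: lee_lim.
- apply: is_cvg_nneseries => n *.
  by apply: nneseries_ge0 => m *; exact: (wG_ge0 (n, m)).
- apply: is_cvg_nneseries => n *; apply: adde_ge0 => //.
  exact: hausdorff2_pre_ge0.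
- by near=> n; apply: lee_sum => i _; exact: (PG i).2.
Unshelve. all: by end_near. Qed.

Lemma hausdorff2_ge0 A : 0 <= hausdorff2 A.
Proof.
apply: (le_trans (hausdorff2_pre_ge0 1 A)).
by apply: ereal_sup_ubound; exists 1%R => //=.
Qed.

Lemma hausdorff2_0 : hausdorff2 set0 = 0.
Proof.
apply/eqP; rewrite eq_le hausdorff2_ge0 andbT.
by apply: ge_ereal_sup => _ [d /= d0 <-]; rewrite hausdorff2_pre0.
Qed.

Lemma hausdorff2_subset_sigma_subadditive A (F : (set 'rV[R]_3)^nat) :
  subset_sigma_subadditive hausdorff2 A F.
Proof.
move=> AF; apply: ge_ereal_sup => _ [d /= d0 <-].
apply: (@le_trans _ _ (hausdorff2_pre d (\bigcup_n F n))).
  exact: le_hausdorff2_pre.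
apply: (le_trans (hausdorff2_pre_sigma_subadditive d F)).
apply: lee_nneseries => k *; first exact: hausdorff2_pre_ge0.
by apply: ereal_sup_ubound; exists d.
Qed.

HB.instance Definition _ := isSubsetOuterMeasure.Build R 'rV[R]_3 hausdorff2
  hausdorff2_0 hausdorff2_ge0 hausdorff2_subset_sigma_subadditive.

End hausdorff2.

Definition surface_measure (R : realType) :
    {outer_measure set 'rV[R]_3 -> \bar R} := @hausdorff2 R.

Definition surface_integral (R : realType) (S : set 'rV[R]_3)
    (f : 'rV[R]_3 -> R) : R :=
  \int[(surface_measure R :
     {measure set (caratheodory_type (surface_measure R)) -> \bar R})]_(r in S) f r.

Section geometry.
Variable R : realType.
Implicit Types (S Omega : set 'rV[R]_3) (rho : 'rV[R]_3 -> R) (p n : 'rV[R]_3).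

Definition local_equation S p rho : Prop :=
  exists V : set 'rV[R]_3, [/\ open V, V p, smooth_on V rho,
    (forall x, V x -> grad rho x != 0) &
    (forall x, V x -> (S x <-> rho x = 0))].

(* Smooth surfaces embedded in R^3, without boundary. *)
Definition smooth_surface S : Prop :=
  forall p, S p -> exists rho, local_equation S p rho.

(* The normal line of a surface at p is spanned by the gradient of any local
   equation. *)
Definition inward_unit_normal Omega p n : Prop :=
  [/\ enorm n = 1,
      (exists rho (a : R), local_equation (bdry Omega) p rho /\
                           n = a *: grad rho p) &
      \forall t \near (0 : R)^'+, Omega (p + t *: n)].

Definition convex_body (K : set 'rV[R]_3) : Prop :=
  [/\ compact K, interior K !=set0 &
      convex_set (K : set (convex_lmodType 'rV[R]_3))].

Definition convex_exterior_domain Omega : Prop :=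
  [/\ open Omega /\ connected Omega, ~ bounded_set Omega,
      smooth_surface (bdry Omega),
      connected (bdry Omega) /\ compact (bdry Omega) &
      convex_body (~` Omega)].

End geometry.

Section dirichlet.
Variable R : realType.
Implicit Types (Omega : set 'rV[R]_3) (U G : 'rV[R]_3 -> R).

Record exterior_dirichlet Omega (n : 'rV[R]_3 -> 'rV[R]_3) U (Phi : R) : Prop
    := ExteriorDirichlet {
  extU_harmonic : harmonic_on Omega U ;
  extU_nonconstant : ~ exists k, forall r, Omega r -> U r = k ;
  extU_smooth : smooth_up_to_boundary Omega U ;
  extU_bdry : exists k, forall r, bdry Omega r -> U r = k ;
  extU_normal : forall r, bdry Omega r -> inward_unit_normal Omega r (n r) ;
  extU_flux : - surface_integral (bdry Omega)
                  (fun r => dot (n r) (closure_grad Omega U r)) = Phi ;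
  extU_flux_gt0 : 0 < Phi ;
  extU_infty : U r / (Phi / (4 * pi * enorm r)) @[r --> @enorm_infty R] --> (1 : R)
}.

(* The unit flux alone does not exclude multipoles at the pole, hence the last
   condition: G has the singularity 1 / (4 pi |r|) there. *)
Record interior_green Omega G : Prop := InteriorGreen {
  intG_pole : ~ closure Omega 0 ;
  intG_harmonic : harmonic_on (~` (closure Omega `|` [set 0])) G ;
  intG_continuous : {within ~` (Omega `|` [set 0]), continuous G} ;
  intG_bdry : forall r, bdry Omega r -> G r = 0 ;
  intG_flux :
    - surface_integral (sphere 0 e) (fun r => dot (e^-1 *: r) (grad G r))
      @[e --> (0 : R)^'+] --> (1 : R) ;
  intG_singularity : G r / (1 / (4 * pi * enorm r)) @[r --> (0 : 'rV[R]_3)^'] --> (1 : R)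
}.

Definition equipotential (D : set 'rV[R]_3) (f : 'rV[R]_3 -> R) (c : R) :
    set 'rV[R]_3 := [set r | D r /\ f r = c].

(* |grad f| is constant on S; at the points of S on the boundary of the open set
   A, the gradient is the limit of the gradient taken inside A. *)
Definition constant_grad_norm (A : set 'rV[R]_3) (f : 'rV[R]_3 -> R)
    (S : set 'rV[R]_3) : Prop :=
  exists C : R, forall r, S r ->
    exists2 v, grad f x @[x --> within A (nbhs r)] --> v & enorm v = C.

End dirichlet.

(* Main.v *)
(* Both parts rest on the weak maximum principle and on unique continuation for
   C^2 harmonic functions.

   Unique continuation: the gradient estimate from a harmonic comparison
   function on a half cube also bounds difference quotients, so that k-fold
   differences of step h are O((C k h)^k).  If a harmonic function vanishes near
   a point, Newton's interpolation formula turns this into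
   |u(p + t e_i)| <= (24 |t| / rho)^k M for every k, hence u vanishes on a cube of
   a definite size.

   (i) If the level is the boundary value, the boundary lies on the sphere.
   Otherwise the sphere lies in the exterior domain.  It encloses the convex
   body, as U would be constant in the ball otherwise; hence U = c rho / |r - a|
   outside the ball, then in the whole domain, and U = k on the boundary makes
   |r - a| constant there.

   (ii) Let p and q be points of the level set {G = c} at minimal distance s and
   maximal distance S from the pole.  Comparison with the Green functions of
   these two balls, shifted by c, gives
   |grad G(p)| >= 1 / (4 pi s^2) and |grad G(q)| <= 1 / (4 pi S^2).
   Both are the same constant, so S <= s, the two bounds on G coincide,
   and G is radial near the pole, hence everywhere. *)
Require Import Defs.
From mathcomp Require Import all_boot all_order all_algebra.
From mathcomp Require Import all_classical all_reals all_analysis.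
From mathcomp Require Import ring lra.

Set Implicit Arguments.
Unset Strict Implicit.
Unset Printing Implicit Defensive.

Import Order.TTheory GRing.Theory Num.Theory.
Import numFieldNormedType.Exports.

Local Open Scope classical_set_scope.
Local Open Scope ring_scope.

(** * Second derivatives of functions of one real variable *)

(** Harmonicity enters only through the second derivative test on coordinate slices; all estimates
    come from explicit comparison functions, without mean value formula or Poisson kernel.

    In unique continuation the mesh has to be fine enough for the first nodes to fall where the
    function is known to vanish. The number of nodes cancels against the binomial coefficient of
    Newton's formula, so the size of the new zero cube does not depend on that first neighbourhood.
    This is what makes the set of zeros closed.

    Convexity acts through segments and rays: a ray that has left the body never returns, and the
    segment from the pole to a point of the body stays inside.

    In (ii) the level may be the boundary itself, where the gradient is only a limit from inside.
    Both gradient bounds therefore use the mean value theorem on short interior segments. At q the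
    segment follows the limit gradient v, since |v| has to be bounded from above: a step l v raises
    G by about l |v|^2 and brings the point closer to the pole by at most l |v|. *)

Section second_derivative.
Variable R : realType.
Implicit Types (g h : R -> R) (d e : R).

(** [g] will be a slice recentred at the point under study, so the second derivative is only wanted
    at 0. *)
Definition second_derivative g d : Prop := exists g1 : R -> R,
  (\forall t \near 0, is_derive (t : R) 1 g (g1 t)) /\ is_derive (0 : R) 1 g1 d.

(** If [d] were positive, the first derivative, which vanishes at the maximum, would be positive
    just to the right of 0, and the mean value theorem would make [g] exceed [g 0] there. *)
Lemma second_derivative_max g d : second_derivative g d ->
  (\forall t \near 0, g t <= g 0) -> d <= 0.
Proof.
move=> [g1 [dg dg1]] gmax; rewrite leNgt; apply/negP => d0.
have [e /= e0 He] := (nbhs_ballP _ _).1 (filterI dg gmax).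
have inb t : t \in `](- e), e[ -> ball (0 : R) e t.
  by rewrite in_itv/= /ball/= sub0r normrN ltr_norml.
have g10 : g1 0 = 0.
  have H0 : (0 : R) \in `](- e), e[ by rewrite in_itv/= oppr_lt0 e0.
  have /(_ _)[||||dg0 g0] := @derive1_at_max R g (- e) e 0.
  - by rewrite (le_trans _ (ltW e0))// oppr_le0 ltW.
  - by move=> t /inb/He[[]].
  - by [].
  - by move=> t /inb/He[].
  by have [[_ <-] _] := He _ (inb _ H0).
have /cvgrPdist_lt/(_ _ d0) : h^-1 *: ((g1 \o shift 0) (h *: 1) - g1 0)
    @[h --> (0 : R)^'] --> d by case: dg1 => ? <-.
move=> /nbhs_ballP[s /= s0 Hs].
have pos t : 0 < t -> t < s -> 0 < g1 t.
  move=> t0 ts.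
  have : `|d - t^-1 *: ((g1 \o shift 0) (t *: 1) - g1 0)| < d.
    apply: Hs; last by rewrite gt_eqF.
    by rewrite /ball/= sub0r normrN gtr0_norm.
  rewrite /= g10 subr0 addr0 [t *: 1]mulr1 => /(le_lt_trans (ler_norm _)).
  rewrite ltrBlDr ltrDl => /= Ht.
  by have := mulr_gt0 t0 Ht; rewrite mulVKf// gt_eqF.
pose b := Num.min e s / 2.
have m0 : 0 < Num.min e s by rewrite lt_min e0.
have b0 : 0 < b by rewrite divr_gt0.
have bm : b < Num.min e s by rewrite gtr_pMr// invf_lt1// ltr1n.
have /andP[be bs] : (b < e) && (b < s) by rewrite -lt_min.
have inbe t : 0 <= t <= b -> ball (0 : R) e t.
  move=> /andP[t0 tb]; apply: inb; rewrite in_itv/= (lt_le_trans _ t0) ?oppr_lt0//=.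
  exact: le_lt_trans be.
have [c||c cb gbc] := @MVT R g g1 0 b b0.
- by rewrite in_itv/= => /andP[c0 cb]; apply: (He c _).1; apply: inbe; rewrite !ltW.
- apply: continuous_in_subspaceT => c; rewrite inE/= in_itv/= => /inbe/He[[dc _] _].
  exact/differentiable_continuous/derivable1_diffP.
have : g b <= g 0 by apply: (He b _).2; apply: inbe; rewrite lexx ltW.
rewrite -subr_le0 gbc subr0 leNgt mulr_gt0//.
move: cb; rewrite in_itv/= => /andP[c0 cb]; apply: pos => //; exact: lt_trans bs.
Qed.

Lemma second_derivativeD g h d e : second_derivative g d ->
  second_derivative h e -> second_derivative (fun t => g t + h t) (d + e).
Proof.
move=> [g1 [dg dg1]] [h1 [dh dh1]]; exists (g1 + h1); split.
  by apply: filterS2 dg dh => t dgt dht; exact: is_deriveD.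
exact: is_deriveD.
Qed.

Lemma second_derivativeZ (k : R) g d : second_derivative g d ->
  second_derivative (fun t => k * g t) (k * d).
Proof.
move=> [g1 [dg dg1]]; exists (k *: g1); split.
  by apply: filterS dg => t dgt; exact: is_deriveZ.
exact: is_deriveZ.
Qed.

Lemma second_derivative_quadratic (a b c : R) :
  second_derivative (fun t => a + b * t + c * t ^+ 2) (2 * c).
Proof.
exists (fun t => b + 2 * c * t); split.
  near=> t.
  have -> : (fun t => a + b * t + c * t ^+ 2) =
      cst a + b *: (@id R) + c *: ((@id R) ^+ 2) by apply/funext.
  apply: (is_derive_eq (is_deriveD (is_deriveD (is_derive_cst a t 1)
    (is_deriveZ b (is_derive_id t 1))) (is_deriveZ c (is_deriveX 2 (is_derive_id t 1))))).
  rewrite /= add0r expr1 /GRing.scale/=; ring.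
have -> : (fun t => b + 2 * c * t) = cst b + (2 * c) *: (@id R) by apply/funext.
apply: (is_derive_eq (is_deriveD (is_derive_cst b (0 : R) 1)
  (is_deriveZ (2 * c) (is_derive_id (0 : R) 1)))).
by rewrite /= add0r /GRing.scale/= mulr1.
Unshelve. all: by end_near. Qed.

Lemma second_derivativeN g d : second_derivative g d ->
  second_derivative (fun t => g (- t)) d.
Proof.
move=> [g1 [dg dg1]]; exists (fun t => - g1 (- t)); split.
  have : \forall t \near - (0 : R), is_derive (t : R) 1 g (g1 t) by rewrite oppr0.
  rewrite nearN => dgN; near=> t.
  have dgt : is_derive (- t) 1 g (g1 (- t)) by near: t; exact: dgN.
  have := @is_derive1_comp R g -%R t (g1 (- t)) (-1) dgt (is_deriveNid t 1).
  by rewrite mulrN1.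
have dgt : is_derive (- (0 : R)) 1 g1 d by rewrite oppr0.
have := @is_derive1_comp R g1 -%R 0 d (-1) dgt (is_deriveNid (0 : R) 1).
by move=> /is_deriveN; rewrite mulrN1 opprK.
Unshelve. all: by end_near. Qed.

(** This is a slice of 1 / |y - a| through x: [q] is |x - a|^2 and [b] a coordinate of x - a. *)
Lemma second_derivative_inv_sqrt (q b : R) : 0 < q ->
  second_derivative (fun t => (Num.sqrt (q + 2 * b * t + t ^+ 2))^-1)
    (3 * b ^+ 2 / Num.sqrt q ^+ 5 - 1 / Num.sqrt q ^+ 3).
Proof.
move=> q0; pose w t : R := q + 2 * b * t + t ^+ 2; pose s t := Num.sqrt (w t).
have dw (t : R) : is_derive t 1 w (2 * (b + t)).
  have -> : w = cst q + (2 * b) *: (@id R) + (@id R) ^+ 2 by apply/funext.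
  apply: (is_derive_eq (is_deriveD (is_deriveD (is_derive_cst q t 1)
    (is_deriveZ (2 * b) (is_derive_id t 1))) (is_deriveX 2 (is_derive_id t 1)))).
  rewrite /= add0r expr1 /GRing.scale/=; ring.
have ds (t : R) : 0 < w t -> is_derive t 1 s ((b + t) / s t).
  move=> wt; have dsw := is_derive1_sqrt wt.
  have := is_derive1_comp dsw (dw t).
  move=> ds; apply: (is_derive_eq ds); rewrite /s.
  have : Num.sqrt (w t) != 0 by rewrite sqrtr_eq0 -ltNge.
  by move=> ?; field.
have s0 (t : R) : 0 < w t -> s t != 0 by move=> wt; rewrite sqrtr_eq0 -ltNge.
have dV (t : R) : 0 < w t -> is_derive t 1 (fun y => (s y)^-1) (- (b + t) / s t ^+ 3).
  move=> wt; apply: (is_derive_eq (is_deriveV (s0 _ wt) (ds _ wt))).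
  by rewrite /GRing.scale/=; have := s0 _ wt; move: (s t) => y y0; field.
exists (fun t => - (b + t) / s t ^+ 3); split.
  have : \forall t \near (0 : R), 0 < w t.
    have cw : {for 0, continuous w}.
      by apply/differentiable_continuous/derivable1_diffP; case: (dw 0).
    have w0 : 0 < w 0 by rewrite /w mulr0 expr0n/= !addr0.
    exact: (cvgr_gt _ cw).
  by apply: filterS => t /dV.
have w0 : 0 < w 0 by rewrite /w mulr0 expr0n/= !addr0.
have s3 : (s ^+ 3) 0 != 0 by rewrite exprfctE expf_neq0// s0.
have -> : (fun t => - (b + t) / s t ^+ 3) =
    (- (cst b + @id R)) * (fun y => ((s ^+ 3) y)^-1).
  by apply/funext => t; rewrite /= exprfctE.
have d0 := ds _ w0; have dV3 := is_deriveV s3 (is_deriveX 3 d0).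
apply: (is_derive_eq (is_deriveM (is_deriveN (is_deriveD (is_derive_cst b (0 : R) 1)
  (is_derive_id (0 : R) 1))) dV3)); rewrite /= /GRing.scale/= !exprfctE.
have sq : s 0 = Num.sqrt q by rewrite /s /w mulr0 expr0n/= !addr0.
rewrite sq; have : Num.sqrt q != 0 by rewrite -sq s0.
move: (Num.sqrt q) => y y0 /=.
by rewrite [(- _) 0](_ : _ = - (b + 0))//; field.
Qed.

End second_derivative.

(** * Euclidean space and the weak maximum principle *)

Lemma ord3P (i : 'I_3) : i = 0 \/ i = 1 \/ i = 2%:R.
Proof. by case: i => -[|[|[|//]]] i3; [left|right; left|right; right]; exact/val_inj. Qed.

Section euclidean.
Variable R : realType.
Local Notation V := 'rV[R]_3.
Implicit Types (u v w x y : V) (k : R).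

Lemma dotE u v : dot u v = u 0 0 * v 0 0 + u 0 1 * v 0 1 + u 0 2%:R * v 0 2%:R.
Proof.
rewrite /dot !big_ord_recl big_ord0 addr0 addrA; congr (_ + _ * _ + _ * _);
  by congr (_ 0 _); apply/val_inj.
Qed.

Lemma dotC u v : dot u v = dot v u.
Proof. by rewrite /dot; apply: eq_bigr => i _; rewrite mulrC. Qed.

Lemma dotDl u v w : dot (u + v) w = dot u w + dot v w.
Proof. by rewrite /dot -big_split/=; apply: eq_bigr => i _; rewrite mxE mulrDl. Qed.

Lemma dotZl k u v : dot (k *: u) v = k * dot u v.
Proof. by rewrite /dot mulr_sumr; apply: eq_bigr => i _; rewrite mxE mulrA. Qed.

Lemma dotDr u v w : dot u (v + w) = dot u v + dot u w.
Proof. by rewrite dotC dotDl !(dotC u). Qed.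

Lemma dotZr k u v : dot u (k *: v) = k * dot u v.
Proof. by rewrite dotC dotZl dotC. Qed.

Lemma dotNl u v : dot (- u) v = - dot u v.
Proof. by rewrite -scaleN1r dotZl mulN1r. Qed.

Lemma dotNr u v : dot u (- v) = - dot u v.
Proof. by rewrite dotC dotNl dotC. Qed.

Lemma dot0l u : dot 0 u = 0.
Proof. by rewrite -(scale0r u) dotZl mul0r. Qed.

Lemma dot_ge0 u : 0 <= dot u u.
Proof. by apply: sumr_ge0 => i _; rewrite -expr2 sqr_ge0. Qed.

Lemma dot_delta u (i : 'I_3) : dot u (delta_mx 0 i) = u 0 i.
Proof.
rewrite /dot (bigD1 i)//= big1 ?addr0 => [|j ji]; rewrite mxE eqxx/= ?mulr1 ?eqxx ?mulr1//.
by rewrite (negbTE ji) mulr0.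
Qed.

Lemma enorm_ge0 u : 0 <= enorm u.
Proof. exact: sqrtr_ge0. Qed.

Lemma sqr_enorm u : enorm u ^+ 2 = dot u u.
Proof. by rewrite sqr_sqrtr// dot_ge0. Qed.

Lemma enorm_eq0 u : enorm u = 0 -> u = 0.
Proof.
move=> u0; apply/rowP => i; rewrite mxE; apply/eqP; rewrite -sqrf_eq0.
have : dot u u = 0 by rewrite -sqr_enorm u0 expr0n.
move/eqP; rewrite /dot psumr_eq0 => [/allP/(_ i)|j _]; last by rewrite -expr2 sqr_ge0.
by rewrite mem_index_enum expr2 => /(_ isT).
Qed.

Lemma enorm0 : enorm (0 : V) = 0.
Proof. by rewrite /enorm dot0l sqrtr0. Qed.

Lemma enorm_gt0 u : u != 0 -> 0 < enorm u.
Proof.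
move=> u0; rewrite lt_neqAle enorm_ge0 andbT eq_sym.
by apply: contra u0 => /eqP/enorm_eq0 ->.
Qed.

Lemma enormZ k u : enorm (k *: u) = `|k| * enorm u.
Proof.
by rewrite /enorm dotZl dotZr mulrA -expr2 sqrtrM ?sqr_ge0// sqrtr_sqr.
Qed.

Lemma enormN u : enorm (- u) = enorm u.
Proof. by rewrite -scaleN1r enormZ normrN1 mul1r. Qed.

Lemma enormB u v : enorm (u - v) = enorm (v - u).
Proof. by rewrite -enormN opprB. Qed.

Lemma dot_le u v : dot u v <= enorm u * enorm v.
Proof.
apply: (le_trans (ler_norm _)).
rewrite -ler_sqr ?nnegrE ?mulr_ge0 ?enorm_ge0// real_normK ?num_real//.
rewrite exprMn !sqr_enorm !dotE.
move: (u 0 0) (u 0 1) (u 0 2%:R) (v 0 0) (v 0 1) (v 0 2%:R) => a b c d e f.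
(* Lagrange's identity: the defect in the Cauchy-Schwarz inequality is the squared norm of the cross
   product. *)
rewrite -subr_ge0; have -> : (a * a + b * b + c * c) * (d * d + e * e + f * f) -
  (a * d + b * e + c * f) ^+ 2 =
  (a * e - b * d) ^+ 2 + (a * f - c * d) ^+ 2 + (b * f - c * e) ^+ 2 by ring.
by rewrite !addr_ge0// sqr_ge0.
Qed.

Lemma enormD u v : enorm (u + v) <= enorm u + enorm v.
Proof.
rewrite -ler_sqr ?nnegrE ?addr_ge0 ?enorm_ge0// sqrrD !sqr_enorm.
rewrite dotDl !dotDr (dotC v u).
have := dot_le u v; lra.
Qed.

Lemma enorm_triangle u v w : enorm (u - w) <= enorm (u - v) + enorm (v - w).
Proof. by rewrite (le_trans _ (enormD _ _))// addrA subrK. Qed.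

Lemma coord_le u (i : 'I_3) : `|u 0 i| <= `|u|.
Proof. by rewrite [leRHS]/Num.norm/= mx_normrE; apply/bigmax_geP; right; exists (0, i). Qed.

Lemma norm_ltP u k : 0 < k -> (forall i : 'I_3, `|u 0 i| < k) -> `|u| < k.
Proof.
move=> k0 uk; rewrite [ltLHS]/Num.norm/= mx_normrE; apply/bigmax_ltP.
by split => // -[a b] _ /=; rewrite (ord1 a).
Qed.

Lemma norm_leP u k : 0 <= k -> (forall i : 'I_3, `|u 0 i| <= k) -> `|u| <= k.
Proof.
move=> k0 uk; rewrite [leLHS]/Num.norm/= mx_normrE; apply/bigmax_leP.
by split => // -[a b] _ /=; rewrite (ord1 a).
Qed.

Lemma norm_le_enorm u : `|u| <= enorm u.
Proof.
apply: norm_leP => [|i]; first exact: enorm_ge0.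
rewrite -ler_sqr ?nnegrE ?enorm_ge0// real_normK ?num_real// sqr_enorm /dot.
rewrite (bigD1 i)//= expr2 lerDl sumr_ge0// => j _.
by rewrite -expr2 sqr_ge0.
Qed.

(** The sharp factor would be the square root of 3. *)
Lemma enorm_le_norm u : enorm u <= 2 * `|u|.
Proof.
rewrite -ler_sqr ?nnegrE ?enorm_ge0 ?mulr_ge0// sqr_enorm exprMn.
apply: (@le_trans _ _ (\sum_(i < 3) `|u| ^+ 2)).
  apply: ler_sum => i _; rewrite -expr2 -[leLHS]real_normK ?num_real//.
  by rewrite lerXn2r ?nnegrE// coord_le.
by rewrite sumr_const card_ord; have := sqr_ge0 `|u|; lra.
Qed.

Lemma enorm_continuous (a : V) : continuous (fun x => enorm (x - a)).
Proof.
move=> x; apply/(@cvgrPdist_lt _ _ _ (nbhs x)) => e e0.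
apply/nbhs_ballP; exists (e / 2) => /= [|y]; first by rewrite divr_gt0.
rewrite -ball_normE /= distrC => xy.
have D1 := enorm_triangle x y a.
have D2 := enorm_triangle y x a; rewrite [enorm (y - x)]enormB in D2.
have D3 : enorm (x - y) < e.
  by rewrite enormB (le_lt_trans (enorm_le_norm _))// mulrC -ltr_pdivlMr.
by rewrite ltr_norml; apply/andP; split; lra.
Qed.

Lemma sqnorm_continuous (a : V) : continuous (fun x => dot (x - a) (x - a)).
Proof.
rewrite (_ : (fun x => _) = (fun x => enorm (x - a) * enorm (x - a))).
  move=> x.
  exact: (continuousM (@enorm_continuous a x) (@enorm_continuous a x)).
by apply/funext => x; rewrite -expr2 sqr_enorm.
Qed.

Lemma line_continuous x w : continuous (fun t : R => x + t *: w).
Proof.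
move=> t.
exact: (continuousD (@cst_continuous R V x t) (@scalel_continuous R V w t)).
Qed.

Lemma translation_continuous w : continuous (fun y : V => y + w).
Proof.
move=> y; have cid : {for y, continuous (@id V)} by move=> A.
exact: (continuousD cid (@cst_continuous V V w y)).
Qed.

Lemma is_derive_line (f : V -> R) x v (t : R) : derivable f (x + t *: v) v ->
  is_derive t 1 (fun s => f (x + s *: v)) ('D_v f (x + t *: v)).
Proof.
pose g s := f (x + s *: v).
have E : (fun h : R => h^-1 *: ((g \o shift t) (h *: 1) - g t)) =
  (fun h => h^-1 *: ((f \o shift (x + t *: v)) (h *: v) - f (x + t *: v))).
  apply/funext => h; rewrite /g /=; congr (_ *: (f _ - _)).
  by rewrite [h *: 1]mulr1 scalerDl addrCA.
by move=> df; apply: DeriveDef; rewrite /derivable /derive E.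
Qed.

Lemma compact_enorm_annulus (a : V) (r M : R) :
  compact [set x | r <= enorm (x - a) <= M].
Proof.
apply: bounded_closed_compact.
  exists (M + enorm a); split; first exact: num_real.
  move=> N MN x /= /andP[_ xM].
  rewrite (le_trans (norm_le_enorm _))// ltW// (le_lt_trans _ MN)//.
  by rewrite -[in leLHS](subrK a x) (le_trans (enormD _ _))// lerD2r.
have -> : [set x | r <= enorm (x - a) <= M] =
    (fun x => enorm (x - a)) @^-1` `[r, M] by apply/seteqP; split => x /=; rewrite in_itv.
apply: closed_comp; last exact: interval_closed.
by move=> x _; exact: enorm_continuous.
Qed.
End euclidean.

(** * Harmonic functions, their symmetries, and the weak maximum principle *)

Section harmonic.
Variable R : realType.
Local Notation V := 'rV[R]_3.
Local Notation e_ i := (delta_mx 0 i : V).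
Implicit Types (u v : V -> R) (x p : V) (A C D : set V).

Definition slice u x (i : 'I_3) : R -> R := fun t => u (x + t *: e_ i).

(** Only second derivatives along the axes at one point are recorded. The second derivative test
    needs no more, and this is easier to check for comparison functions than C^2 regularity. *)
Definition has_laplacian u x (L : R) : Prop := exists d : 'I_3 -> R,
  (forall i, second_derivative (slice u x i) (d i)) /\ \sum_i d i = L.

Definition harmonic_at u x : Prop :=
  {for x, continuous u} /\ has_laplacian u x 0.

Lemma has_laplacianD u v x L M : has_laplacian u x L -> has_laplacian v x M ->
  has_laplacian (fun y => u y + v y) x (L + M).
Proof.
move=> [d [ud <-]] [e [ve <-]]; exists (fun i => d i + e i); split.
  by move=> i; exact: (second_derivativeD (ud i) (ve i)).
by rewrite big_split.
Qed.

Lemma has_laplacianZ (k : R) u x L : has_laplacian u x L ->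
  has_laplacian (fun y => k * u y) x (k * L).
Proof.
move=> [d [ud <-]]; exists (fun i => k * d i); split.
  by move=> i; exact: (second_derivativeZ k (ud i)).
by rewrite mulr_sumr.
Qed.

Lemma has_laplacian_cst (k : R) x : has_laplacian (fun=> k) x 0.
Proof.
exists (fun=> 2 * 0); split => [i|]; last by rewrite mulr0 big1.
have := second_derivative_quadratic k 0 0.
by congr second_derivative; apply/funext => t; rewrite /slice !mul0r !addr0.
Qed.

(** The polynomial comparison functions are quadratic along each axis, so their Laplacian is read
    off from coefficients. *)
Lemma has_laplacian_quadratic (a b c : 'I_3 -> R) u x :
  (forall i t, u (x + t *: e_ i) = a i + b i * t + c i * t ^+ 2) ->
  has_laplacian u x (2 * \sum_i c i).
Proof.
move=> uE; exists (fun i => 2 * c i); split; last by rewrite mulr_sumr.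
move=> i; have := second_derivative_quadratic (a i) (b i) (c i).
by congr second_derivative; apply/funext => t; rewrite /slice uE.
Qed.

Lemma coordD x (i j : 'I_3) (t : R) : (x + t *: e_ i) 0 j = x 0 j + (j == i)%:R * t.
Proof. by rewrite !mxE eqxx/= mulrC. Qed.

Lemma dot_slice x (i : 'I_3) (t : R) : dot (x + t *: e_ i) (x + t *: e_ i) =
  dot x x + 2 * x 0 i * t + t ^+ 2.
Proof.
rewrite dotDl !dotDr !dotZl !dotZr (dotC (e_ i) x) !dot_delta mxE !eqxx/=; ring.
Qed.

Lemma has_laplacian_sqnorm p x : has_laplacian (fun y => dot (y - p) (y - p)) x 6.
Proof.
have -> : 6 = 2 * \sum_(i < 3) 1 :> R by rewrite sumr_const card_ord; lra.
apply: (has_laplacian_quadratic (a := fun=> dot (x - p) (x - p))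
  (b := fun i => 2 * (x - p) 0 i)) => i t.
by rewrite addrAC dot_slice mul1r.
Qed.

Lemma has_laplacian_coord p (j : 'I_3) x : has_laplacian (fun y => (y - p) 0 j) x 0.
Proof.
have -> : 0 = 2 * \sum_(i < 3) 0 :> R by rewrite big1 ?mulr0.
apply: (has_laplacian_quadratic (a := fun=> (x - p) 0 j)
  (b := fun i => (j == i)%:R)) => i t.
by rewrite addrAC coordD mul0r addr0.
Qed.

Lemma has_laplacian_sqcoord p (j : 'I_3) x :
  has_laplacian (fun y => (y - p) 0 j ^+ 2) x 2.
Proof.
have -> : 2 = 2 * \sum_(i < 3) (j == i)%:R :> R.
  rewrite (bigD1 j)//= big1 ?addr0 ?eqxx ?mulr1// => i ij.
  by rewrite eq_sym (negbTE ij).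
apply: (has_laplacian_quadratic (a := fun=> (x - p) 0 j ^+ 2)
  (b := fun i => 2 * (x - p) 0 j * (j == i)%:R)) => i t.
rewrite addrAC coordD; by case: (j == i) => /=; ring.
Qed.

Lemma harmonic_atD u v x : harmonic_at u x -> harmonic_at v x ->
  harmonic_at (fun y => u y + v y) x.
Proof.
move=> [cu lu] [cv lv]; split; first exact: (continuousD cu cv).
by have := has_laplacianD lu lv; rewrite addr0.
Qed.

Lemma harmonic_atZ (k : R) u x : harmonic_at u x ->
  harmonic_at (fun y => k * u y) x.
Proof.
move=> [cu lu]; split; first exact: (continuousM (@cst_continuous _ _ k x) cu).
by have := has_laplacianZ k lu; rewrite mulr0.
Qed.

Lemma harmonic_atN u x : harmonic_at u x -> harmonic_at (fun y => - u y) x.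
Proof.
move=> /(harmonic_atZ (-1)); congr harmonic_at.
by apply/funext => y; rewrite mulN1r.
Qed.

Lemma harmonic_atB u v x : harmonic_at u x -> harmonic_at v x ->
  harmonic_at (fun y => u y - v y) x.
Proof. by move=> hu /harmonic_atN; exact: harmonic_atD. Qed.

Lemma harmonic_at_cst (k : R) x : harmonic_at (fun=> k) x.
Proof. by split; [exact: cst_continuous | exact: has_laplacian_cst]. Qed.

Lemma harmonic_at_shift (w : V) u x : harmonic_at u (x + w) ->
  harmonic_at (fun y => u (y + w)) x.
Proof.
move=> [cu [d [ud d0]]]; split.
  exact: (continuous_comp (@translation_continuous R w x) cu).
exists d; split => // i; have := ud i.
by congr second_derivative; apply/funext => t; rewrite /slice addrAC.
Qed.

(** Reflection in the plane through [p] orthogonal to axis [i]; it serves to form the part of a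
    harmonic function that is odd across this plane. *)
Definition reflection p (i : 'I_3) x : V := x - (2 * (x - p) 0 i) *: e_ i.

Lemma reflection_coord p (i j : 'I_3) x :
  (reflection p i x - p) 0 j = if j == i then - (x - p) 0 i else (x - p) 0 j.
Proof.
by rewrite /reflection !mxE eqxx/=; case: eqVneq => [->|_] /=; ring.
Qed.

Lemma reflection_slice p (i j : 'I_3) x (t : R) :
  reflection p i (x + t *: e_ j) =
  reflection p i x + (if j == i then - t else t) *: e_ j.
Proof.
apply/rowP => k; rewrite /reflection !mxE eqxx/=.
rewrite (eq_sym i j); have [<-|ji] := eqVneq j i => /=; last by ring.
by case: (k == j) => /=; ring.
Qed.

Lemma reflection_continuous p (i : 'I_3) : continuous (reflection p i).
Proof.
move=> x; have cid : {for x, continuous (@id V)} by move=> A.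
have cc : {for x, continuous (fun y : V => (y - p) 0 i)}.
  exact: (continuous_comp (@translation_continuous R (- p) x) (@coord_continuous R 1 3 0 i _)).
have c2 := continuousM (@cst_continuous V R 2 x) cc.
exact: (continuousB cid (continuousZ c2 (@cst_continuous V V (e_ i) x))).
Qed.

(** A reflection maps axis-parallel lines to such lines and at most reverses the parameter, which a
    second derivative does not see. *)
Lemma harmonic_at_reflection p (i : 'I_3) u x : harmonic_at u (reflection p i x) ->
  harmonic_at (fun y => u (reflection p i y)) x.
Proof.
move=> [cu [d [ud d0]]]; split.
  exact: (continuous_comp (@reflection_continuous p i x) cu).
exists d; split => // j.
have -> : slice (fun y => u (reflection p i y)) x j =
  fun t => slice u (reflection p i x) j (if j == i then - t else t).
  by apply/funext => t; rewrite /slice reflection_slice.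
by case: (j == i); [exact: second_derivativeN | exact: ud].
Qed.

(** The squares of the coordinates add up to r^2, so the sum over the axes is 3 r^2 / r^5 - 3 / r^3
    = 0. *)
Lemma harmonic_at_inv_enorm (a x : V) : x != a ->
  harmonic_at (fun y => (enorm (y - a))^-1) x.
Proof.
move=> xa; have r0 : 0 < enorm (x - a) by rewrite enorm_gt0// subr_eq0.
have q0 : 0 < dot (x - a) (x - a) by rewrite -sqr_enorm exprn_gt0.
split; first by apply: continuousV; [rewrite gt_eqF | exact: enorm_continuous].
exists (fun i => 3 * (x - a) 0 i ^+ 2 / enorm (x - a) ^+ 5 - 1 / enorm (x - a) ^+ 3).
split => [i|].
  have := second_derivative_inv_sqrt ((x - a) 0 i) q0.
  congr second_derivative; apply/funext => t.
  by rewrite /slice -dot_slice addrAC.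
rewrite big_split/= -mulr_suml -mulr_sumr.
have -> : \sum_(i < 3) (x - a) 0 i ^+ 2 = enorm (x - a) ^+ 2.
  by rewrite sqr_enorm; apply: eq_bigr => i _; rewrite expr2.
rewrite sumr_const card_ord -mulr_natl.
by move: (enorm _) r0 => r /gt_eqF/negbT r0; field.
Qed.

(** Passage from the C^2 notion of the statement to the pointwise one; openness keeps short slices
    inside [A]. *)
Lemma harmonic_on_at A u x : open A -> harmonic_on A u -> A x -> harmonic_at u x.
Proof.
move=> oA [Au lu] Ax; split; first exact: ((Au x Ax).1 [::]).
exists (fun i => partials [:: i; i] u x); split => [i|]; last exact: lu.
exists (fun t => partial i u (x + t *: e_ i)).
split.
  have : \forall t \near (0 : R), A (x + t *: e_ i).
    by apply: line_continuous; rewrite scale0r addr0; exact: open_nbhs_nbhs.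
  by apply: filterS => t Axt; apply: is_derive_line; exact: ((Au _ Axt).2 [::] i).
rewrite -[x in partials _ _ x]addr0 -(scale0r (e_ i)).
by apply: is_derive_line; rewrite scale0r addr0; exact: ((Au x Ax).2 [:: i] i).
Qed.

(* Adding a small multiple of the squared norm makes the Laplacian positive,
   which the second derivative test excludes at an interior maximum. *)
Lemma weak_maximum_principle C D u (m : R) : compact C -> {within C, continuous u} ->
  open D -> D `<=` C -> (forall x, D x -> has_laplacian u x 0) ->
  (forall x, C x -> ~ D x -> u x <= m) -> forall x, C x -> u x <= m.
Proof.
move=> cC cu oD DC hu um x0 Cx0; rewrite leNgt; apply/negP => mu.
have [B [B0 HB]] : exists B : R, 0 < B /\ forall x, C x -> dot x x <= B.
  have [N [_ HN]] := compact_bounded cC.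
  pose b := Num.max 1 (N + 1); have b1 : 1 <= b by rewrite le_max lexx.
  have b0 : 0 < b by rewrite (lt_le_trans _ b1).
  exists ((2 * b) ^+ 2); split; first by rewrite exprn_gt0// mulr_gt0.
  move=> x Cx; rewrite -sqr_enorm lerXn2r ?nnegrE ?enorm_ge0 ?mulr_ge0 ?(ltW b0)//.
  rewrite (le_trans (enorm_le_norm _))// ler_pM2l//.
  by apply: (HN b) => //; rewrite lt_max ltrDl ltr01 orbT.
(* With this [eta] the perturbation is at most (u x0 - m) / 2 on [C], so a point where [u] is at
   most [m] cannot be the maximum of [v]: the maximum lies in [D]. *)
pose eta := (u x0 - m) / (2 * B).
have eta0 : 0 < eta by rewrite divr_gt0 ?subr_gt0 ?mulr_gt0.
pose v y := u y + eta * dot (y - 0) (y - 0).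
have [|c] := compact_EVT_max (f := v) (ex_intro _ x0 Cx0) cC.
  apply/subspace_continuousP => y Cy.
  apply: cvgD; first by move/subspace_continuousP: cu; exact.
  apply: cvgM; first exact: cvg_cst.
  apply: cvg_within_filter; exact: sqnorm_continuous.
rewrite inE => Cc vmax.
have vx0 : u x0 <= v c.
  apply: (@le_trans _ _ (v x0)); last by apply: vmax; rewrite inE.
  by rewrite /v lerDl mulr_ge0 ?dot_ge0 ?ltW.
have Dc : D c.
  apply: contrapT => Dc; have := um _ Cc Dc; have := HB _ Cc.
  move: vx0; rewrite /v subr0 => vx0 cB uc.
  have : eta * dot c c <= eta * B by rewrite ler_pM2l.
  have -> : eta * B = (u x0 - m) / 2 by rewrite /eta; field; rewrite gt_eqF.
  lra.
have [d [vd]] := has_laplacianD (hu _ Dc) (has_laplacianZ eta (has_laplacian_sqnorm 0 c)).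
rewrite add0r => d6; have : \sum_i d i <= 0.
  apply: sumr_le0 => i _; apply: (second_derivative_max (vd i)).
  have : \forall t \near (0 : R), D (c + t *: e_ i).
    by apply: line_continuous; rewrite scale0r addr0; exact: open_nbhs_nbhs.
  apply: filterS => t Dt; rewrite /slice scale0r addr0.
  by apply: vmax; rewrite inE; exact: DC.
by rewrite d6 leNgt mulr_gt0.
Qed.

End harmonic.

(** * Unique continuation *)

Section finite_differences.
Variable R : realType.
Implicit Types (f : nat -> R) (B : R).

Definition forward_diff f : nat -> R := fun j => f j.+1 - f j.

(** In Newton's interpolation formula all terms of order below [k] vanish. The induction on [k]
    needs only Pascal's rule, since [forward_diff f] starts with one zero less than [f]. *)
Lemma newton_bound k f N B : (forall j, (j < k)%N -> f j = 0) ->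
  (forall j, (j + k <= N)%N -> `|iter k forward_diff f j| <= B) ->
  forall j, (j <= N)%N -> `|f j| <= 'C(j, k)%:R * B.
Proof.
elim: k f N => [|k IH] f N f0 fB; first by move=> j jN; rewrite bin0 mul1r fB ?addn0.
case: N fB => [|N] fB.
  by case=> // _; rewrite f0// normr0 bin0n mul0r.
have IHd : forall j, (j <= N)%N -> `|forward_diff f j| <= 'C(j, k)%:R * B.
  apply: IH => [j jk|j jN].
    by rewrite /forward_diff !f0 ?subrr// ltnS ltnW.
  by rewrite -iterSr; apply: fB; rewrite addnS ltnS.
elim=> [_|j IHj jN]; first by rewrite f0// normr0 bin0n mul0r.
rewrite -(subrK (f j) (f j.+1)) (le_trans (ler_normD _ _))//.
rewrite binS natrD mulrDl addrC lerD// ?IHj 1?ltnW//.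
exact: IHd.
Qed.

Lemma bin_le_exp2 n k : ('C(n, k) <= 2 ^ n)%N.
Proof.
elim: n k => [|n IH] [|k]; rewrite ?bin0 ?bin0n ?expn_gt0//.
by rewrite binS expnS mul2n -addnn leq_add.
Qed.

Lemma expn_le_ffact n k : (n ^ k <= (n + k) ^_ k)%N.
Proof.
elim: k => [|k IH]; first by rewrite ffactn0.
by rewrite addnS ffactnS expnS leq_mul// (leq_trans (leq_addr k n))// leqnSn.
Qed.

Lemma ffact_le_expn n k : (n ^_ k <= n ^ k)%N.
Proof.
elim: k n => [|k IH] n; first by rewrite ffactn0.
rewrite ffactnS expnS leq_mul// (leq_trans (IH _))//.
by case: k {IH} => // k; rewrite leq_exp2r// leq_pred.
Qed.

(** The bound C(N, k) <= (4 N / k)^k without division. In place of Stirling's formula, k^k is at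
    most the falling factorial of 2k of length k, which is C(2k, k) k! <= 4^k k!. *)
Lemma bin_expn_le N k : ('C(N, k) * k ^ k <= 4 ^ k * N ^ k)%N.
Proof.
have kk : (k ^ k <= 4 ^ k * k`!)%N.
  rewrite (leq_trans (expn_le_ffact _ _))// -bin_ffact leq_mul//.
  by rewrite (leq_trans (bin_le_exp2 _ _))// addnn -mul2n expnM.
rewrite (leq_trans (leq_mul (leqnn _) kk))// mulnCA leq_mul// bin_ffact.
exact: ffact_le_expn.
Qed.

End finite_differences.

(** * From bounds on iterated differences to unique continuation *)

Section unique_continuation.
Variable R : realType.
Local Notation V := 'rV[R]_3.
Local Notation e_ i := (delta_mx 0 i : V).
Implicit Types (u : V -> R) (x p : V) (A D S : set V).

Lemma near_normP (x : V) (P : set V) :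
  (\forall y \near x, P y) <-> exists2 d : R, 0 < d & forall y, `|y - x| < d -> P y.
Proof.
split=> [/nbhs_ballP[d /= d0 H]|[d d0 H]].
  by exists d => // y xy; apply: H; rewrite -ball_normE /= distrC.
apply/nbhs_ballP; exists d => // y; rewrite -ball_normE /= distrC; exact: H.
Qed.

Lemma norm_e (i : 'I_3) (t : R) : `|t *: e_ i| = `|t|.
Proof.
apply/eqP; rewrite eq_le; apply/andP; split.
  apply: norm_leP => // j; rewrite !mxE eqxx/=.
  by case: (j == i); rewrite ?mulr1// mulr0 normr0.
by rewrite (le_trans _ (coord_le _ i))// !mxE !eqxx/= mulr1.
Qed.

(* The comparison function is harmonic, nonnegative on the face y_i = 0 of the
   half cube, where the odd part of u vanishes, and at least M on the other faces. *)
Lemma odd_part_le u p (d M : R) (i : 'I_3) : 0 < d ->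
  (forall x, `|x - p| <= d -> harmonic_at u x /\ `|u x| <= M) ->
  forall s, 0 <= s <= d -> u (p + s *: e_ i) - u (p - s *: e_ i) <= 6 * M * s / d.
Proof.
move=> d0 uM s /andP[s0 sd].
have M0 : 0 <= M.
  have /uM[_] : `|p - p| <= d by rewrite subrr normr0; exact: ltW.
  exact: le_trans.
(* Write y = x - p. The coefficient -3 cancels the Laplacian 6 of |y|^2. On the face y_i = d the two
   terms in y_i cancel and |y|^2 >= d^2 remains; on a face |y_j| = d the sum is at least d^2 + y_i
   (3 d - 2 y_i). In [w] the factor 2 matches the bound 2 M on the odd part, which gives the final 6
   = 2 * 3. *)
pose psi x := (M / d ^+ 2) * ((dot (x - p) (x - p) + (3 * d) * (x - p) 0 i) +
   (-3) * (x - p) 0 i ^+ 2).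
pose w x := (u x - u (reflection p i x)) - 2 * psi x.
pose C := [set x : V | `|x - p| <= d /\ 0 <= (x - p) 0 i].
pose D := [set x : V | `|x - p| < d /\ 0 < (x - p) 0 i].
have cN : continuous (fun x : V => `|x - p|).
  move=> x; exact: (continuous_comp (@translation_continuous R (- p) x) (@norm_continuous _ _ _)).
have cc : continuous (fun x : V => (x - p) 0 i).
  move=> x; exact: (continuous_comp (@translation_continuous R (- p) x) (@coord_continuous R 1 3 0 i _)).
have reflC x : `|x - p| <= d -> `|reflection p i x - p| <= d.
  move=> xd; apply: norm_leP => [|j]; first exact: ltW.
  by rewrite reflection_coord; case: ifP => _; rewrite ?normrN (le_trans (coord_le _ _)).
have hpsi x : harmonic_at psi x.
  apply: harmonic_atZ; split.
    have c1 := continuousM (@cst_continuous V R (3 * d) x) (cc x).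
    have c2 := continuousM (@cst_continuous V R (-3) x) (continuousM (cc x) (cc x)).
    exact: (continuousD (continuousD (@sqnorm_continuous R p x) c1) c2).
  have := has_laplacianD (has_laplacianD (has_laplacian_sqnorm p x)
    (has_laplacianZ (3 * d) (has_laplacian_coord p i x)))
    (has_laplacianZ (-3) (has_laplacian_sqcoord p i x)).
  by have -> : 6 + 3 * d * 0 + -3 * 2 = 0 :> R by ring.
have hw x : C x -> harmonic_at w x.
  move=> [xd _]; apply: harmonic_atB; last exact: harmonic_atZ.
  apply: harmonic_atB; first exact: (uM x xd).1.
  by apply: harmonic_at_reflection; exact: (uM _ (reflC _ xd)).1.
have cC : compact C.
  apply: bounded_closed_compact.
    exists (d + `|p|); split; first exact: num_real.
    move=> N dN x [xd _] /=; rewrite ltW// (le_lt_trans _ dN)//.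
    by rewrite -[in leLHS](subrK p x) (le_trans (ler_normD _ _))// lerD2r.
  apply: closedI.
    apply: (@closed_comp _ _ (fun x : V => `|x - p|) [set y : R | y <= d]) => [x _|].
      exact: cN.
    exact: closed_le.
  apply: (@closed_comp _ _ (fun x : V => (x - p) 0 i) [set y : R | 0 <= y]) => [x _|].
    exact: cc.
  exact: closed_ge.
have oD : open D.
  apply: openI.
    apply: (@open_comp _ _ (fun x : V => `|x - p|) [set y : R | y < d]) => [x _|].
      exact: cN.
    exact: open_lt.
  apply: (@open_comp _ _ (fun x : V => (x - p) 0 i) [set y : R | 0 < y]) => [x _|].
    exact: cc.
  exact: open_gt.
have wle x : C x -> w x <= 0.
  have DC : D `<=` C by move=> y [/ltW yd /ltW y0]; split.
  apply: (weak_maximum_principle cC _ oD DC).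
  - by apply: continuous_in_subspaceT => y /set_mem/hw[].
  - by move=> y /DC/hw[].
  move=> {}x [xd x0] nDx; rewrite /w subr_le0.
  have Md : 0 <= M / d ^+ 2 by rewrite divr_ge0// exprn_ge0// ltW.
  have [xi0|xin0] := eqVneq ((x - p) 0 i) 0.
    rewrite /reflection xi0 mulr0 scale0r subr0 subrr mulr_ge0// mulr_ge0//.
    by rewrite xi0 expr0n/= !mulr0 !addr0 dot_ge0.
  have xi : 0 < (x - p) 0 i by rewrite lt_neqAle eq_sym xin0.
  have [j jd] : exists j : 'I_3, d <= `|(x - p) 0 j|.
    apply: contrapT => /forallNP H; apply: nDx; split => //.
    by apply: norm_ltP => // j; rewrite ltNge; apply/negP/H.
  have psiM : M <= psi x.
    rewrite /psi -{1}(divfK (_ : d ^+ 2 != 0) M); last by rewrite sqrf_eq0 gt_eqF.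
    apply: ler_wpM2l => //.
    have xid : (x - p) 0 i <= d by rewrite (le_trans (ler_norm _))// (le_trans (coord_le _ _)).
    have d2 : d ^+ 2 <= (x - p) 0 j ^+ 2.
      by rewrite -[leRHS]real_normK ?num_real// lerXn2r ?nnegrE// ltW.
    have [ji|ji] := eqVneq j i.
      have S : (x - p) 0 i ^+ 2 <= dot (x - p) (x - p).
        by rewrite /dot (bigD1 i)//= expr2 lerDl sumr_ge0// => k _; rewrite -expr2 sqr_ge0.
      move: d2; rewrite ji => d2.
      by have := mulr_ge0 (ltW xi) (_ : 0 <= d - (x - p) 0 i); rewrite subr_ge0 => /(_ xid); nra.
    have S : (x - p) 0 i ^+ 2 + (x - p) 0 j ^+ 2 <= dot (x - p) (x - p).
      rewrite /dot (bigD1 i)//= (bigD1 j)//= addrA !expr2 lerDl sumr_ge0// => k _.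
      by rewrite -expr2 sqr_ge0.
    by have := mulr_ge0 (ltW xi) (_ : 0 <= d - (x - p) 0 i); rewrite subr_ge0 => /(_ xid); nra.
  have u1 := (uM _ xd).2; have u2 := (uM _ (reflC _ xd)).2.
  rewrite (le_trans (ler_norm _))// (le_trans (ler_normB _ _))//.
  by lra.
have Cs : C (p + s *: e_ i).
  by split; rewrite /= addrC addKr ?norm_e ?ger0_norm// !mxE !eqxx/= mulr1.
have := wle _ Cs; rewrite /w subr_le0.
have -> : reflection p i (p + s *: e_ i) = p - s *: e_ i.
  rewrite /reflection; have -> : (p + s *: e_ i - p) 0 i = s.
    by rewrite addrC addKr !mxE !eqxx/= mulr1.
  by apply/rowP => k; rewrite !mxE; ring.
move=> /le_trans; apply; rewrite /psi (addrC p) addrK dotZl dotZr dot_delta !mxE !eqxx/= !mulr1.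
have -> : 2 * (M / d ^+ 2 * (s * s + 3 * d * s + -3 * s ^+ 2)) =
   6 * M * s / d - 4 * (M * s ^+ 2 / d ^+ 2) by field; rewrite gt_eqF.
have : 0 <= M * s ^+ 2 / d ^+ 2 by exact: (divr_ge0 (mulr_ge0 M0 (sqr_ge0 _)) (sqr_ge0 _)).
lra.
Qed.

Lemma symmetric_diff_bound u p (d M : R) (i : 'I_3) : 0 < d ->
  (forall x, `|x - p| <= d -> harmonic_at u x /\ `|u x| <= M) ->
  forall s, `|s| <= d -> `|u (p + s *: e_ i) - u (p - s *: e_ i)| <= 6 * M * `|s| / d.
Proof.
move=> d0 uM s; wlog s0 : s / 0 <= s.
  move=> H; have [/H//|/ltW s0 sd] := leP 0 s.
  have := H (- s); rewrite oppr_ge0 normrN scaleNr opprK distrC; exact.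
rewrite ger0_norm// => sd; have s0d : 0 <= s <= d by rewrite s0.
have uN x : `|x - p| <= d -> harmonic_at (fun y => - u y) x /\ `|- u x| <= M.
  by move=> /uM[hx xM]; rewrite normrN; split => //; exact: harmonic_atN.
have := odd_part_le i d0 uM s0d; have := odd_part_le i d0 uN s0d.
by rewrite ler_norml => ? ?; apply/andP; split; lra.
Qed.

Definition shift_diff (w : V) u : V -> R := fun x => u (x + w) - u x.

(** A difference over the step [h] is a symmetric difference about the midpoint, so the previous
    bound applies on the cube of half-side d / 2 centred there. Each use costs [d] of the radius. *)
Lemma shift_diff_bound u p (r d M h : R) (i : 'I_3) : 0 < d -> 2 * `|h| <= d ->
  (forall x, `|x - p| < r -> harmonic_at u x /\ `|u x| <= M) ->
  forall x, `|x - p| < r - d ->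
    harmonic_at (shift_diff (h *: e_ i) u) x /\
    `|shift_diff (h *: e_ i) u x| <= 6 * `|h| / d * M.
Proof.
move=> d0 hd uM x xr.
have near_x y : `|y - x| <= d -> `|y - p| < r.
  move=> yx; rewrite -(subrK x y) -addrA (le_lt_trans (ler_normD _ _))//; lra.
split.
  apply: harmonic_atB.
    have /near_x/uM[uxh _] : `|x + h *: e_ i - x| <= d.
      by rewrite addrC addKr norm_e; have := normr_ge0 h; lra.
    exact: harmonic_at_shift.
  have /near_x/uM[//] : `|x - x| <= d by rewrite subrr normr0; exact: ltW.
have hp : h / 2 + h / 2 = h by field.
have := @symmetric_diff_bound u (x + (h / 2) *: e_ i) (d / 2) M i _ _ (h / 2).
rewrite -addrA -scalerDl hp addrK normrM [`|2^-1|]gtr0_norm ?invr_gt0//.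
have -> : 6 * `|h| / d * M = 6 * M * (`|h| / 2) / (d / 2).
  by field; rewrite gt_eqF.
apply; first by rewrite divr_gt0.
  move=> y yd; apply: uM; apply: near_x.
  have -> : y - x = (y - (x + (h / 2) *: e_ i)) + (h / 2) *: e_ i.
    by rewrite opprD addrA subrK.
  rewrite (le_trans (ler_normD _ _))// norm_e normrM [`|2^-1|]gtr0_norm ?invr_gt0//.
  have := normr_ge0 h; lra.
have := normr_ge0 h; lra.
Qed.

(** Differences of harmonic functions are harmonic, so the bound iterates. With d = rho / k the loss
    of radius over k steps is rho altogether. *)
Lemma iter_shift_diff_bound u p (r d M h : R) (i : 'I_3) k : 0 < d -> 2 * `|h| <= d ->
  (forall x, `|x - p| < r -> harmonic_at u x /\ `|u x| <= M) ->
  forall x, `|x - p| < r - k%:R * d ->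
    harmonic_at (iter k (shift_diff (h *: e_ i)) u) x /\
    `|iter k (shift_diff (h *: e_ i)) u x| <= (6 * `|h| / d) ^+ k * M.
Proof.
move=> d0 hd uM; elim: k => [|k IH] x.
  by rewrite mul0r subr0 expr0 mul1r; exact: uM.
rewrite -natr1 mulrDl mul1r opprD addrA => xr.
by rewrite iterS exprS -mulrA; exact: shift_diff_bound IH _ xr.
Qed.

Lemma iter_forward_diff u x (w : V) k j :
  iter k (@forward_diff R) (fun j => u (x + j%:R *: w)) j =
  iter k (shift_diff w) u (x + j%:R *: w).
Proof.
elim: k j => [//|k IH] j; rewrite !iterS /forward_diff !IH /shift_diff.
by rewrite -natr1 scalerDl scale1r addrA.
Qed.

Lemma harmonic_vanish_line u p (rho M delta t : R) (i : 'I_3) : 0 < rho -> 0 < delta ->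
  (forall x, `|x - p| < 2 * rho -> harmonic_at u x /\ `|u x| <= M) ->
  (forall x, `|x - p| < delta -> u x = 0) ->
  `|t| <= rho / 48 -> u (p + t *: e_ i) = 0.
Proof.
move=> rho0 delta0 uM u0 trho.
have M0 : 0 <= M.
  have /uM[_] : `|p - p| < 2 * rho by rewrite subrr normr0 mulr_gt0.
  exact: le_trans.
have bound k : `|u (p + t *: e_ i)| <= (2^-1) ^+ k.+1 * M.
  have k0 : 0 < k.+1%:R :> R by rewrite ltr0n.
  (* The segment is cut into [N] steps h = t / N. The summands of [K] make [N] large enough for 2
     |h| <= d and for the first k + 1 nodes to lie where [u] vanishes. The order k + 1 keeps d = rho
     / (k + 1) meaningful for every k. *)
  pose K := 2 * `|t| * k.+1%:R / rho + `|t| * k.+1%:R / delta.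
  have K0 : 0 <= K by rewrite addr_ge0// !mulr_ge0// invr_ge0 ltW.
  pose N := maxn k.+1 (Num.bound K).
  have KN : K < N%:R.
    by rewrite (lt_le_trans (archi_boundP K0))// ler_nat leq_maxr.
  have N0 : 0 < N%:R :> R by exact: le_lt_trans KN.
  have hK1 : 2 * `|t| * k.+1%:R / rho <= N%:R.
    by rewrite (le_trans _ (ltW KN))// lerDl !mulr_ge0// invr_ge0 ltW.
  have hK2 : `|t| * k.+1%:R / delta < N%:R.
    by rewrite (le_lt_trans _ KN)// lerDr !mulr_ge0// invr_ge0 ltW.
  pose h := t / N%:R; have nh : `|h| = `|t| / N%:R.
    by rewrite normrM normfV [`|N%:R|]gtr0_norm.
  pose d := rho / k.+1%:R; have d0 : 0 < d by rewrite divr_gt0.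
  have hd : 2 * `|h| <= d.
    rewrite nh /d ler_pdivlMr// mulrA mulrAC ler_pdivrMr//.
    by rewrite [leRHS]mulrC -ler_pdivrMr.
  pose f j := u (p + j%:R *: (h *: e_ i)).
  have := @newton_bound R k.+1 f N ((6 * `|h| / d) ^+ k.+1 * M) _ _ N (leqnn N).
  have -> : f N = u (p + t *: e_ i).
    by rewrite /f scalerA /h mulrCA divff ?mulr1// gt_eqF.
  move=> H; apply: (le_trans (H _ _)).
  - move=> j jk; rewrite /f scalerA; apply: u0.
    rewrite addrC addKr norm_e normrM nh normr_nat mulrA ltr_pdivrMr//.
    apply: (@le_lt_trans _ _ (`|t| * k.+1%:R)).
      by rewrite mulrC ler_wpM2l// ler_nat ltnW.
    by rewrite [ltRHS]mulrC -ltr_pdivrMr.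
  - move=> j jN; rewrite /f iter_forward_diff.
    apply: (@iter_shift_diff_bound u p (2 * rho) d M h i k.+1 d0 hd uM _ _).2.
    have -> : k.+1%:R * d = rho by rewrite /d mulrC divfK// gt_eqF.
    rewrite addrC addKr scalerA norm_e normrM nh normr_nat mulrA.
    apply: (@le_lt_trans _ _ `|t|); last lra.
    by rewrite ler_pdivrMr// mulrC ler_wpM2l// ler_nat (leq_trans _ jN)// leq_addr.
  rewrite mulrA ler_wpM2r//.
  (* The factor (4 N / (k + 1))^(k + 1) from the binomial coefficient meets (6 (k + 1) |t| / (N
     rho))^(k + 1). Both [N] and k + 1 cancel, leaving the base 24 |t| / rho <= 1 / 2; [delta] has
     disappeared with [N]. *)
  have := bin_expn_le N k.+1; rewrite -(ler_nat R) !natrM !natrX => HC.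
  have -> : (6 * `|h| / d) ^+ k.+1 = k.+1%:R ^+ k.+1 * (6 * `|t| / (N%:R * rho)) ^+ k.+1.
    rewrite -exprMn; congr (_ ^+ _); rewrite nh /d; field.
    by rewrite !gt_eqF.
  rewrite mulrA (le_trans (ler_wpM2r _ HC))//.
    by rewrite exprn_ge0// divr_ge0 ?mulr_ge0// ltW.
  rewrite -!exprMn lerXn2r ?nnegrE//.
    by rewrite !mulr_ge0// invr_ge0 mulr_ge0// ltW.
  have -> : 4 * N%:R * (6 * `|t| / (N%:R * rho)) = 24 * `|t| / rho.
    by field; rewrite !gt_eqF.
  by rewrite ler_pdivrMr//; lra.
apply/eqP; rewrite -normr_le0 leNgt; apply/negP => a0.
pose a := `|u (p + t *: e_ i)|; have Ma0 : 0 <= M / a by rewrite divr_ge0// ltW.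
pose k := Num.bound (M / a).
have := bound k; rewrite leNgt => /negP; apply.
rewrite exprVn mulrC ltr_pdivrMr ?exprn_gt0// mulrC -ltr_pdivrMr//.
apply: (lt_trans (archi_boundP Ma0)); rewrite -natrX ltr_nat.
by rewrite (ltn_trans (ltnSn _))// ltn_expl.
Qed.

(** A displacement is made along one axis at a time. The centres stay within [rho] of [p] and each
    line estimate looks 2 rho further, hence the radius 3 rho. *)
Lemma harmonic_vanish_cube u p (rho M : R) : 0 < rho ->
  (forall x, `|x - p| < 3 * rho -> harmonic_at u x /\ `|u x| <= M) ->
  (\forall x \near p, u x = 0) ->
  forall x, `|x - p| < rho / 48 -> u x = 0.
Proof.
move=> rho0 uM u0.
pose Z : set V := fun q => \forall x \near q, u x = 0.
(* The line lemma is applied at every [z] near [q], so that a whole neighbourhood of zeros is moved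
   and the next axis can follow. *)
have step q (t : R) (i : 'I_3) : Z q -> `|q - p| < rho -> `|t| < rho / 48 ->
    Z (q + t *: e_ i).
  move=> /near_normP[delta delta0 Hq] qp tr; apply/near_normP.
  pose eta := Num.min (delta / 2) (rho - `|q - p|).
  have eta0 : 0 < eta by rewrite lt_min divr_gt0//= subr_gt0.
  exists eta => // y yq.
  have -> : y = (y - t *: e_ i) + t *: e_ i by rewrite subrK.
  have : `|y - t *: e_ i - q| < eta by rewrite -addrA -opprD [t *: _ + q]addrC.
  move: (y - t *: e_ i) => z {yq y}; rewrite lt_min => /andP[z1 z2].
  apply: (@harmonic_vanish_line u z rho M (delta / 2)) => //; last exact: ltW.
  - by rewrite divr_gt0.
  - move=> x xz; apply: uM.
    have -> : x - p = (x - z) + (z - q) + (q - p) by rewrite !addrA !subrK.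
    rewrite (le_lt_trans (ler_normD _ _))//.
    have := ler_normD (x - z) (z - q); lra.
  - move=> x xz; apply: Hq; rewrite -(subrK z x) -addrA.
    rewrite (le_lt_trans (ler_normD _ _))//; lra.
move=> x xp.
pose y (i : 'I_3) := (x - p) 0 i.
have yi i : `|y i| < rho / 48 by rewrite (le_lt_trans (coord_le _ _)).
have Z0 : Z p by [].
have Z1 : Z (p + y 0 *: e_ 0) by apply: step => //; rewrite subrr normr0.
have Z2 : Z (p + y 0 *: e_ 0 + y 1 *: e_ 1).
  by apply: step => //; rewrite addrC addKr norm_e (lt_trans (yi 0))//; lra.
have Z3 : Z (p + y 0 *: e_ 0 + y 1 *: e_ 1 + y 2%:R *: e_ 2%:R).
  apply: step => //; rewrite -(addrA p) [p + _]addrC addrK (le_lt_trans (ler_normD _ _))//.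
  rewrite !norm_e; have := yi 0; have := yi 1; lra.
have <- : p + y 0 *: e_ 0 + y 1 *: e_ 1 + y 2%:R *: e_ 2%:R = x.
  apply/rowP => j; rewrite /y !mxE !eqxx/=.
  have [->|[->|->]] := ord3P j.
  - by rewrite [0 == 0]isT [0 == 1](_ : _ = false)// [0 == 2%:R](_ : _ = false)//=; ring.
  - by rewrite [1 == 0](_ : _ = false)// [1 == 1]isT [1 == 2%:R](_ : _ = false)//=; ring.
  - by rewrite [2%:R == 0](_ : _ = false)// [2%:R == 1](_ : _ = false)// eqxx /=; ring.
exact: nbhs_singleton Z3.
Qed.

(** The points of [S] near which [u] vanishes form an open and closed part. Closedness holds because
    the size rho / 48 of the zero cube depends only on a bound for [u] near the limit point [x], so
    the cube around a close enough zero point [z] contains [x]. [S] need not be open: it will be a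
    segment. *)
Lemma unique_continuation D S u x0 : open D -> (forall x, D x -> harmonic_at u x) ->
  connected S -> S `<=` D -> S x0 -> (\forall x \near x0, u x = 0) ->
  forall x, S x -> u x = 0.
Proof.
move=> oD hu cS SD Sx0 ux0.
pose Z : set V := fun q => \forall x \near q, u x = 0.
suff ZS : S `&` Z = S by move=> x; rewrite -ZS => -[_ /nbhs_singleton].
apply: cS; first by exists x0.
  exists Z => //; rewrite openE => q Zq; exact: (near_join Zq).
exists (closure Z); first exact: closed_closure.
apply/seteqP; split => [x [Sx Zx]|x [Sx clZx]].
  by split => //; exact: subset_closure.
split => //.
have nD : \forall y \near x, D y by exact: (open_nbhs_nbhs (conj oD (SD _ Sx))).
have nb : \forall y \near x, `|u y| <= `|u x| + 1.
  have [cu _] := hu _ (SD _ Sx).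
  have : \forall y \near x , `|u x - u y| < 1 by exact: (@cvgr_dist_lt _ _ _ (nbhs x) _ u (u x) cu _ ltr01).
  apply: filterS => y uxy; rewrite -(subrK (u x) (u y)) addrC.
  by rewrite (le_trans (ler_normD _ _))// lerD2l distrC ltW.
have [d d0 Hd] := (near_normP _ _).1 (filterI nD nb).
pose rho := d / 4; have rho0 : 0 < rho by rewrite divr_gt0.
have [z [Zz zx]] : exists z, Z z /\ `|z - x| < rho / 48.
  have /(clZx _)[z [Zz zx]] : \forall z \near x, `|z - x| < rho / 48.
    by apply/near_normP; exists (rho / 48) => //; rewrite divr_gt0.
  by exists z.
have H := @harmonic_vanish_cube u z rho (`|u x| + 1) rho0 _ Zz.
apply/near_normP; exists (rho / 48 - `|z - x|); first by rewrite subr_gt0.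
move=> y yx; apply: H.
  move=> q qz; have /Hd[Dq uq] : `|q - x| < d.
    rewrite -(subrK z q) -addrA (le_lt_trans (ler_normD _ _))//.
    by rewrite /rho in qz zx; lra.
  by split => //; exact: hu.
rewrite -(subrK x y) -addrA (le_lt_trans (ler_normD _ _))// [`|x - z|]distrC; lra.
Qed.

End unique_continuation.

(** * Convex bodies and directional derivatives *)

Section convex_bodies.
Variable R : realType.
Local Notation V := 'rV[R]_3.
Implicit Types (K Omega : set V) (a p x w z : V).

Lemma convex_body_line K x z (t : R) : convex_body K -> K x -> K z -> 0 <= t <= 1 ->
  K (x + t *: (z - x)).
Proof.
move=> [_ _ cK] Kx Kz /andP[t0 t1].
have /(_ z x (Itv01 t0 t1)) := cK; rewrite !inE => /(_ Kz Kx).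
have -> : conv (Itv01 t0 t1) (z : convex_lmodType V) x = x + t *: (z - x) :> V.
  by rewrite [LHS](_ : _ = t *: z + (1 - t) *: x)//; apply/rowP => i; rewrite !mxE; ring.
by [].
Qed.

(** The homothety with centre [z] and ratio 1 - t maps a neighbourhood of [x] in [K] onto a
    neighbourhood of the point; [x'] is the preimage of [y]. *)
Lemma convex_body_interior_line K x z (t : R) : convex_body K -> interior K x -> K z ->
  0 <= t < 1 -> interior K (x + t *: (z - x)).
Proof.
move=> bK /near_normP[d d0 Kd] Kz /andP[t0 t1]; apply/near_normP.
have t10 : 0 < 1 - t by rewrite subr_gt0.
exists ((1 - t) * d) => [|y yd]; first exact: mulr_gt0.
pose x' := x + (1 - t)^-1 *: (y - (x + t *: (z - x))).
have -> : y = x' + t *: (z - x').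
  apply/rowP => i; rewrite !mxE; field; rewrite gt_eqF//.
apply: convex_body_line => //; last by rewrite t0 ltW.
apply: Kd; rewrite /x' addrC addKr normrZ gtr0_norm ?invr_gt0//.
by rewrite ltr_pdivrMl.
Qed.

(** [T] is the largest parameter for which the ray is in [K], attained by compactness. *)
Lemma convex_body_exit K x w : convex_body K -> interior K x -> w != 0 ->
  exists T : R, [/\ 0 < T, K (x + T *: w), ~ interior K (x + T *: w) &
    forall t, 0 <= t < T -> interior K (x + t *: w)].
Proof.
move=> bK Kx w0; have [cK _ _] := bK.
have w_gt0 : 0 < `|w| by rewrite normr_gt0.
have [N [_ KN]] := compact_bounded cK.
pose B := (N + 1 + `|x|) / `|w|.
pose S : set R := [set t | t \in `[0, B] /\ K (x + t *: w)].
have SB (t : R) : 0 <= t -> K (x + t *: w) -> S t.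
  move=> t0 Kt; split => //; rewrite in_itv/= t0/= ler_pdivlMr//.
  have /(_ _ Kt)/= : forall y, K y -> `|y| <= N + 1 by apply: KN; rewrite ltrDl.
  have := ler_normB (x + t *: w) x; rewrite addrC addKr normrZ (ger0_norm t0); lra.
have clK : closed K by apply: compact_closed => //; exact: norm_hausdorff.
have cS : compact S.
  apply: (subclosed_compact _ (@segment_compact R 0 B)); last by move=> t [].
  apply: closedI; first exact: interval_closed.
  apply: (@closed_comp _ _ (fun t : R => x + t *: w) K) => // t _.
  exact: line_continuous.
have S0 : S 0 by apply: SB => //; rewrite scale0r addr0; exact: nbhs_singleton.
have cid : {within S, continuous (@id R)}.
  by apply: continuous_subspaceT => t A.
have [T /set_mem[+ KT] Tmax] := compact_EVT_max (ex_intro _ _ S0) cS cid.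
rewrite in_itv/= => /andP[T0 _].
have Tint : ~ interior K (x + T *: w).
  move=> /near_normP[d d0 Kd].
  have e0 : 0 < d / (2 * `|w|) by rewrite divr_gt0// mulr_gt0.
  have /mem_set/Tmax : S (T + d / (2 * `|w|)).
    apply: SB; first by rewrite addr_ge0// ltW.
    apply: Kd; rewrite [X in `|X|](_ : _ = (d / (2 * `|w|)) *: w).
      rewrite normrZ gtr0_norm//.
      have -> : d / (2 * `|w|) * `|w| = d / 2 by field; rewrite gt_eqF.
      by rewrite ltr_pdivrMr// ltr_pMr// ltr1n.
    by rewrite scalerDl addrA [LHS]addrC addKr.
  by rewrite leNgt /= ltrDl e0.
have Tpos : 0 < T.
  rewrite lt_neqAle T0 andbT eq_sym; apply/eqP => T00; apply: Tint.
  by rewrite T00 scale0r addr0.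
exists T; split => // t /andP[t0 tT].
have -> : x + t *: w = x + (t / T) *: (x + T *: w - x).
  by rewrite [x + T *: w]addrC addrK scalerA divfK// gt_eqF.
apply: convex_body_interior_line => //.
by rewrite divr_ge0//= ltr_pdivrMr// mul1r.
Qed.

Lemma bdry_openE Omega : open Omega ->
  bdry Omega = ~` Omega `\` interior (~` Omega).
Proof.
move=> oO; rewrite /bdry interiorC; have /interior_id -> := oO.
by apply/seteqP; split=> x [? ?]; split => //; exact: contrapT.
Qed.

(** A boundary contained in a sphere is all of it. An interior point [x] lies in the open ball, as
    the ray from [x] away from [a] must still reach the sphere. The ray from [x] through [p] exits
    [K] on the sphere, and it meets the sphere only once, at [p]. *)
Lemma bdry_sphere K a (r : R) : convex_body K -> 0 < r ->
  (forall x, K x -> ~ interior K x -> enorm (x - a) = r) ->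
  forall p, enorm (p - a) = r -> K p /\ ~ interior K p.
Proof.
move=> bK r0 Ka p pr; have [_ [x Kx] _] := bK.
have xr : enorm (x - a) < r.
  have [->|xa] := eqVneq x a; first by rewrite subrr enorm0.
  have xa0 : x - a != 0 by rewrite subr_eq0.
  have [T [T0 KT nKT _]] := convex_body_exit bK Kx xa0.
  have := Ka _ KT nKT.
  have -> : x + T *: (x - a) - a = (1 + T) *: (x - a).
    by rewrite scalerDl scale1r addrAC.
  rewrite enormZ gtr0_norm ?addr_gt0// => <-.
  by rewrite ltr_pMl ?enorm_gt0// ltrDl.
have px : p - x != 0.
  by rewrite subr_eq0; apply: contraTneq xr => <-; rewrite pr ltxx.
have [T [T0 KT nKT _]] := convex_body_exit bK Kx px.
suff T1 : T = 1 by move: KT nKT; rewrite T1 scale1r addrC subrK.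
have E (t : R) : enorm (x + t *: (p - x) - a) ^+ 2 =
    enorm (x - a) ^+ 2 + 2 * dot (x - a) (p - x) * t + t ^+ 2 * enorm (p - x) ^+ 2.
  rewrite addrAC; move: (x - a) (p - x) => y w.
  rewrite !sqr_enorm dotDl !dotDr !dotZl !dotZr (dotC w y); ring.
have ET := E T; rewrite (Ka _ KT nKT) in ET.
have E1 := E 1; rewrite scale1r addrCA subrr addr0 pr in E1.
have w0 := enorm_gt0 px; have xa0 := enorm_ge0 (x - a).
have {}xr : enorm (x - a) ^+ 2 < r ^+ 2 by rewrite ltr_pXn2r ?nnegrE// ltW.
(* The linear coefficient is eliminated from the equations at t = 1 and t = T; the second factor is
   positive because [x] lies in the open ball. *)
have /eqP : (1 - T) * (r ^+ 2 - enorm (x - a) ^+ 2 + T * enorm (p - x) ^+ 2) = 0.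
  by rewrite {1}E1; move: ET; rewrite {1}E1; lra.
rewrite mulf_eq0 => /orP[/eqP|]; first lra.
by rewrite gt_eqF// addr_gt0 ?subr_gt0// mulr_gt0// exprn_gt0.
Qed.

End convex_bodies.

(** * Directional derivatives of C^1 functions and the mean value theorem *)

Section directional_derivatives.
Variable R : realType.
Local Notation V := 'rV[R]_3.
Local Notation e_ i := (delta_mx 0 i : V).
Implicit Types (f : V -> R) (x y w : V) (A : set V).

Lemma slice_MVT f y (i : 'I_3) (s : R) :
  (forall c, `|c| <= `|s| -> derivable f (y + c *: e_ i) (e_ i)) ->
  exists2 c, `|c| <= `|s| & f (y + s *: e_ i) - f y = partial i f (y + c *: e_ i) * s.
Proof.
move=> df; pose g t := f (y + t *: e_ i).
have dg (c : R) : `|c| <= `|s| -> is_derive c 1 g (partial i f (y + c *: e_ i)).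
  by move=> /df dfc; exact: is_derive_line.
have cg (I : set R) : (forall c, I c -> `|c| <= `|s|) -> {within I, continuous g}.
  move=> Is; apply: continuous_in_subspaceT => c /set_mem/Is/dg[dgc _].
  exact/differentiable_continuous/derivable1_diffP.
have g0 : g 0 = f y by rewrite /g scale0r addr0.
have [s0|s0] := leP 0 s.
  have inI (c : R) : c \in `[0, s] -> `|c| <= `|s|.
    by rewrite in_itv/= => /andP[c0 cs]; rewrite !ger0_norm.
  have [c||c cI] := @MVT_segment R g (fun c => partial i f (y + c *: e_ i)) 0 s s0.
  - by move=> cI; apply: dg; apply: inI; exact: subset_itv_oo_cc cI.
  - by apply: cg => c; exact: inI.
  by rewrite g0 subr0 => H; exists c; [exact: inI | exact: H].
have inI (c : R) : c \in `[s, 0] -> `|c| <= `|s|.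
  by rewrite in_itv/= => /andP[sc c0]; rewrite !ler0_norm ?lerN2// ltW.
have [c||c cI] := @MVT_segment R g (fun c => partial i f (y + c *: e_ i)) s 0 (ltW s0).
- by move=> cI; apply: dg; apply: inI; exact: subset_itv_oo_cc cI.
- by apply: cg => c; exact: inI.
rewrite g0 sub0r => H; exists c; first exact: inI.
by rewrite -[LHS]opprB H mulrN opprK.
Qed.

(** [Ck_on] speaks only of derivatives along the axes. The increment in direction [w] is therefore
    split into three axis-parallel steps, each treated by the mean value theorem and continuity of
    the partial derivatives. *)
Lemma derive_grad A f y w : open A -> Ck_on 1 A f -> A y ->
  derivable f y w /\ 'D_w f y = dot (grad f y) w.
Proof.
move=> oA fA Ay.
suff H : h^-1 *: ((f \o shift y) (h *: w) - f y) @[h --> (0 : R)^'] --> dot (grad f y) w.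
  by split; [apply/cvg_ex; exists (dot (grad f y) w) | exact: cvg_lim].
apply/cvgrPdist_le => e e0.
pose W := 1 + 3 * `|w|; have W1 : 1 <= W by rewrite lerDl mulr_ge0.
have W0 : 0 < W by rewrite (lt_le_trans _ W1).
pose eps := e / W; have eps0 : 0 < eps by rewrite divr_gt0.
have pc i : \forall z \near y, `|partial i f y - partial i f z| < eps.
  have cp : {for y, continuous (partial i f)} by exact: ((fA y Ay).1 [:: i] isT).
  by exact: (@cvgr_dist_lt _ _ _ (nbhs y) _ _ _ cp _ eps0).
have nA : \forall z \near y, A z by exact: open_nbhs_nbhs.
have [d d0 Hd] := (near_normP _ _).1
  (filterI nA (filterI (pc 0) (filterI (pc 1) (pc 2%:R)))).
have step z (i : 'I_3) (s : R) : `|z - y| + `|s| < d ->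
    `|f (z + s *: e_ i) - f z - partial i f y * s| <= eps * `|s|.
  move=> zs; have inb c : `|c| <= `|s| -> `|z + c *: e_ i - y| < d.
    move=> cs; rewrite addrAC (le_lt_trans (ler_normD _ _))// norm_e.
    by rewrite (le_lt_trans _ zs)// lerD2l.
  have [c|c cs ->] := @slice_MVT f z i s.
    by move=> /inb/Hd[Az _]; exact: ((fA _ Az).2 [::] i isT).
  rewrite -mulrBl normrM ler_wpM2r// distrC ltW//.
  have [_ [p0 [p1 p2]]] := Hd _ (inb _ cs).
  by have [E|[E|E]] := ord3P i; subst i.
have h0 : \forall h \near (0 : R), `|h| * W < d.
  apply/nbhs_ballP; exists (d / W) => /= [|h]; first exact: divr_gt0.
  by rewrite /ball/= sub0r normrN ltr_pdivlMr.
near=> h.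
have hn0 : h != 0 by near: h; exact: nbhs_dnbhs_neq.
have hW : `|h| * W < d by near: h; exact: nbhs_dnbhs.
rewrite /=; pose y1 := y + (h * w 0 0) *: e_ 0.
pose y2 := y1 + (h * w 0 1) *: e_ 1.
have wi i : `|h * w 0 i| <= `|h| * `|w| by rewrite normrM ler_wpM2l// coord_le.
have yE : h *: w + y = y2 + (h * w 0 2%:R) *: e_ 2%:R.
  apply/rowP => j; rewrite /y2 /y1 !mxE !eqxx/=.
  have [->|[->|->]] := ord3P j.
  - by rewrite [0 == 0]isT [0 == 1](_ : _ = false)// [0 == 2%:R](_ : _ = false)//=; ring.
  - by rewrite [1 == 0](_ : _ = false)// [1 == 1]isT [1 == 2%:R](_ : _ = false)//=; ring.
  - by rewrite [2%:R == 0](_ : _ = false)// [2%:R == 1](_ : _ = false)// eqxx /=; ring.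
have b0 : `|y - y| + `|h * w 0 0| < d.
  rewrite subrr normr0 add0r (le_lt_trans _ hW)// (le_trans (wi _))// ler_wpM2l//.
  by rewrite /W; have := normr_ge0 w; lra.
have n1 : `|y1 - y| <= `|h| * `|w| by rewrite /y1 addrC addKr norm_e.
have n2 : `|y2 - y| <= `|h| * `|w| + `|h| * `|w|.
  by rewrite /y2 addrAC (le_trans (ler_normD _ _))// lerD// norm_e.
have s0 := step y 0 (h * w 0 0) b0.
have hWE : `|h| * W = `|h| + 3 * (`|h| * `|w|) by rewrite /W; ring.
have hw0 : 0 <= `|h| * `|w| by rewrite mulr_ge0.
have s1 : `|f y2 - f y1 - partial 1 f y * (h * w 0 1)| <= eps * `|h * w 0 1|.
  apply: step; rewrite (le_lt_trans _ hW)// hWE (le_trans (lerD n1 (wi _)))//.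
  by have := normr_ge0 h; lra.
have s2 : `|f (h *: w + y) - f y2 - partial 2%:R f y * (h * w 0 2%:R)| <= eps * `|h * w 0 2%:R|.
  rewrite yE; apply: step; rewrite (le_lt_trans _ hW)// hWE (le_trans (lerD n2 (wi _)))//.
  by have := normr_ge0 h; lra.
rewrite -/y1 in s0.
have -> : dot (grad f y) w - h^-1 *: (f (h *: w + y) - f y) =
    - (h^-1 * ((f y1 - f y - partial 0 f y * (h * w 0 0)) +
    (f y2 - f y1 - partial 1 f y * (h * w 0 1)) +
    (f (h *: w + y) - f y2 - partial 2%:R f y * (h * w 0 2%:R)))).
  by rewrite dotE !mxE /GRing.scale/=; field.
rewrite normrN normrM normfV ler_pdivrMl ?normr_gt0//.
rewrite (le_trans (ler_normD _ _))// (le_trans (lerD (ler_normD _ _) (lexx _)))//.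
rewrite (le_trans (lerD (lerD s0 s1) s2))// -!mulrDr.
have -> : `|h| * e = eps * (`|h| * W).
  by rewrite /eps; field; rewrite gt_eqF.
rewrite ler_wpM2l ?(ltW eps0)// hWE.
by have := wi 0; have := wi 1; have := wi 2%:R; have := normr_ge0 h; lra.
Unshelve. all: by end_near. Qed.

(** The end points need only continuity: in the applications they may lie on the boundary. *)
Lemma line_MVT A f x w (T : R) : open A -> Ck_on 1 A f -> 0 < T ->
  (forall t, 0 < t < T -> A (x + t *: w)) ->
  {within `[0, T], continuous (fun t => f (x + t *: w))} ->
  exists2 c, 0 < c < T & f (x + T *: w) - f x = dot (grad f (x + c *: w)) w * T.
Proof.
move=> oA fA T0 xA cf.
have [c|c] := @MVT R _ (fun c => dot (grad f (x + c *: w)) w) 0 T T0 _ cf.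
  rewrite in_itv/= => /xA/(derive_grad w oA fA)[df <-].
  exact: is_derive_line.
by rewrite in_itv/= scale0r addr0 subr0 => cT H; exists c.
Qed.

End directional_derivatives.

(** * The exterior problem *)

Section dirichlet_tools.
Variable R : realType.
Local Notation V := 'rV[R]_3.
Implicit Types (u : V -> R) (a p x v : V) (A D S Omega : set V).

Lemma connected_segment x v (T : R) : connected [set x + t *: v | t in `[0, T]].
Proof.
apply: connected_continuous_connected; first exact: segment_connected.
by apply: continuous_subspaceT; exact: line_continuous.
Qed.

Lemma continuous_closure_eq0 A u : {within closure A, continuous u} ->
  (forall x, A x -> u x = 0) -> forall x, closure A x -> u x = 0.
Proof.
move=> /subspace_continuousP cu u0 x clx; apply/eqP; rewrite -normr_le0 leNgt.
apply/negP => ux.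
have H : \forall y \near within (closure A) (nbhs x), `|u x - u y| < `|u x|.
  exact: (cvgr_dist_lt _ _ (cu _ clx) _ ux).
have [y [Ay Hy]] := clx _ H; have := Hy (subset_closure Ay).
by rewrite (u0 _ Ay) subr0 ltxx.
Qed.

Lemma open_enorm_annulus a (r s : R) : open [set x : V | r < enorm (x - a) < s].
Proof.
have -> : [set x : V | r < enorm (x - a) < s] =
    (fun x => enorm (x - a)) @^-1` `]r, s[ by apply/seteqP; split => x /=; rewrite in_itv.
apply: open_comp; last exact: interval_open.
by move=> x _; exact: enorm_continuous.
Qed.

Lemma open_enorm_gt a (r : R) : open [set x : V | r < enorm (x - a)].
Proof.
apply: (@open_comp _ _ (fun x : V => enorm (x - a)) [set y | r < y]) => [x _|].
  exact: enorm_continuous.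
exact: open_gt.
Qed.

Lemma annulus_maximum a (r s m : R) u :
  (forall x, r <= enorm (x - a) <= s -> harmonic_at u x) ->
  (forall x, enorm (x - a) = r \/ enorm (x - a) = s -> u x <= m) ->
  forall x, r <= enorm (x - a) <= s -> u x <= m.
Proof.
move=> hu um.
have sub : [set x | r < enorm (x - a) < s] `<=` [set x | r <= enorm (x - a) <= s].
  by move=> x /= /andP[rx xs]; rewrite !ltW.
apply: (weak_maximum_principle (@compact_enorm_annulus _ a r s) _
  (@open_enorm_annulus a r s) sub).
- by apply: continuous_in_subspaceT => x /set_mem/hu[].
- by move=> x /sub/hu[].
move=> x /= /andP[rx xs] nx; apply: um.
have [rx'|rx'|->] := ltgtP r (enorm (x - a)); last by left.
  right; apply/eqP; rewrite eq_le xs leNgt; apply/negP => xs'.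
  by apply: nx; rewrite rx' xs'.
by move: rx; rewrite leNgt rx'.
Qed.

(** Smallness at infinity replaces compactness: the annulus estimate is used with outer radius
    beyond both [M] and the given point. *)
Lemma exterior_maximum a (r : R) u :
  (forall x, r <= enorm (x - a) -> harmonic_at u x) ->
  (forall x, enorm (x - a) = r -> u x <= 0) ->
  (forall e : R, 0 < e -> exists M : R, forall x, M <= enorm (x - a) -> u x <= e) ->
  forall x, r <= enorm (x - a) -> u x <= 0.
Proof.
move=> hu ur uoo x rx; apply/ler_addgt0Pr => e e0; rewrite add0r.
have [M Mu] := uoo _ e0.
pose s := Num.max M (enorm (x - a)).
have Ms : M <= s by rewrite le_max lexx.
have xs : enorm (x - a) <= s by rewrite le_max lexx orbT.
apply: (@annulus_maximum a r s e u); last by rewrite rx.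
  by move=> y /andP[ry _]; exact: hu.
move=> y [/ur yr|ys]; first by rewrite (le_trans yr)// ltW.
by apply: Mu; rewrite ys.
Qed.

(** If the ray came back to the body, [x] would lie on a segment between two points of it. *)
Lemma convex_exterior_ray Omega x y (t : R) : convex_body (~` Omega) ->
  Omega x -> ~ Omega y -> 0 <= t -> Omega (x + t *: (x - y)).
Proof.
move=> bK Ox Ky t0; apply: contrapT => Kt.
have t1 : 0 < 1 + t by rewrite (lt_le_trans ltr01)// lerDl.
have t01 : 0 <= (1 + t)^-1 <= 1 by rewrite invr_ge0 (ltW t1)/= invf_le1// lerDl.
have := convex_body_line bK Ky Kt t01.
by rewrite (_ : _ + _ = x)//; apply/rowP => i; rewrite !mxE; field; rewrite gt_eqF.
Qed.

Lemma bdry_nonempty Omega : open Omega -> convex_body (~` Omega) -> bdry Omega !=set0.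
Proof.
move=> oO bK; have [_ [x Kx] _] := bK.
have e0 : (delta_mx 0 0 : V) != 0.
  by apply/eqP => /rowP/(_ 0)/eqP; rewrite !mxE eqxx oner_eq0.
have [T [_ KT nKT _]] := convex_body_exit bK Kx e0.
by exists (x + T *: delta_mx 0 0); rewrite bdry_openE.
Qed.

End dirichlet_tools.

Section exterior_problem.
Variables (R : realType) (Omega : set 'rV[R]_3).
Local Notation V := 'rV[R]_3.
Hypotheses (oO : open Omega) (bK : convex_body (~` Omega)).
Implicit Types (U : V -> R) (a x : V).

Lemma bdry_eq_sphere a (r : R) : 0 < r ->
  (forall x, bdry Omega x -> enorm (x - a) = r) -> bdry Omega = sphere a r.
Proof.
move=> r0 H; apply/seteqP; split => [x /H//|x xr].
rewrite bdry_openE//; apply: (bdry_sphere bK r0 _ xr) => y Ky nKy.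
by apply: H; rewrite bdry_openE.
Qed.

(** What is kept of the behaviour at infinity: decay for the maximum principle, positivity to
    exclude the level 0. The factor 2 reflects that the quotient is within 1 of its limit 1. *)
Lemma exterior_asymptotics U (Phi : R) : 0 < Phi ->
  U r / (Phi / (4 * pi * enorm r)) @[r --> @enorm_infty R] --> (1 : R) ->
  exists2 k : R, 0 < k & exists2 M : R, 0 < M &
    forall x, M < enorm x -> 0 < U x <= k / enorm x.
Proof.
move=> Phi0 /(_ _ (nbhsx_ballx (1 : R) 1 ltr01))[M _ HM].
exists (2 * (Phi / (4 * pi))).
  by rewrite mulr_gt0// divr_gt0// mulr_gt0// pi_gt0.
exists (Num.max M 1); first by rewrite lt_max ltr01 orbT.
move=> x; rewrite gt_max => /andP[Mx x1].
have x0 : 0 < enorm x by rewrite (lt_trans _ x1).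
have := HM x Mx; rewrite /= /ball/=; have := pi_gt0 R.
move: (@pi R) => P p0 Hx.
have q0 : 0 < Phi / (4 * P * enorm x) by rewrite divr_gt0// !mulr_gt0.
have -> : 2 * (Phi / (4 * P)) / enorm x = 2 * (Phi / (4 * P * enorm x)).
  by field; rewrite !gt_eqF.
move: Hx; rewrite ltr_norml => /andP[H1 H2].
have : 0 < U x / (Phi / (4 * P * enorm x)) by lra.
have : U x / (Phi / (4 * P * enorm x)) <= 2 by lra.
by rewrite ler_pdivrMr// ltr_pdivlMr// mul0r => -> ->.
Qed.

Lemma exterior_sphere_level U (k c : R) a (r kappa M : R) :
  (forall x, Omega x -> harmonic_at U x) ->
  {within closure Omega, continuous U} ->
  (forall x, bdry Omega x -> U x = k) ->
  0 < M -> (forall x, M < enorm x -> 0 < U x <= kappa / enorm x) ->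
  0 < r -> equipotential (closure Omega) U c = sphere a r ->
  exists (b : V) (s : R), 0 < s /\ bdry Omega = sphere b s.
Proof.
move=> hU cU Uk M0 UM r0 lev.
have [ck|ck] := eqVneq c k.
  exists a, r; split => //; apply: bdry_eq_sphere => // x bx.
  have : equipotential (closure Omega) U c x by split; [case: bx | rewrite ck Uk].
  by rewrite lev.
have sO x : enorm (x - a) = r -> Omega x /\ U x = c.
  move=> xr; have [clx Ux] : equipotential (closure Omega) U c x by rewrite lev.
  split => //; apply: contrapT => Ox.
  have /Uk Uxk : bdry Omega x by split => // /interior_subset.
  by move/eqP: ck; rewrite -Ux -Uxk.
(* If no point of the body lies in the open ball, [U] takes the value [c] at the centre too, so the
   centre would belong to the level set, that is, to the sphere. *)
have [[y0 [Ky0 y0r]]|Kout] := pselect (exists y, ~ Omega y /\ enorm (y - a) < r); last first.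
  have ballO x : enorm (x - a) <= r -> Omega x.
    rewrite le_eqVlt => /orP[/eqP/sO[]//|xr].
    by apply: contrapT => Kx; apply: Kout; exists x.
  have ha x : 0 <= enorm (x - a) <= r -> harmonic_at U x by move=> /andP[_ /ballO/hU].
  pose C := [set x : V | 0 <= enorm (x - a) <= r].
  (* The inner radius -1 turns the annulus into the full open ball, centre included. *)
  pose D := [set x : V | -1 < enorm (x - a) < r].
  have DC : D `<=` C by move=> x /= /andP[_ xr]; rewrite /C/= enorm_ge0 ltW.
  have CD x : C x -> ~ D x -> U x = c.
    move=> /= /andP[_ xr] nD; apply: (sO x _).2; apply/eqP; rewrite eq_le xr leNgt.
    by apply/negP => xr'; apply: nD; rewrite /D/= xr' (lt_le_trans _ (enorm_ge0 _))// ltrN10.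
  have wm u m : (forall x, C x -> harmonic_at u x) ->
      (forall x, C x -> ~ D x -> u x <= m) -> u a <= m.
    move=> hu um; apply: (weak_maximum_principle (@compact_enorm_annulus _ a 0 r) _
      (@open_enorm_annulus _ a (-1) r) DC _ um).
    - by apply: continuous_in_subspaceT => x /set_mem/hu[].
    - by move=> x /DC/hu[].
    - by rewrite /= subrr enorm0 lexx ltW.
  have U1 : U a <= c by apply: wm => // x Cx nDx; rewrite CD.
  have U2 : - U a <= - c.
    apply: (wm (fun x => - U x)) => [x /ha|x Cx nDx]; first exact: harmonic_atN.
    by rewrite CD.
  have : equipotential (closure Omega) U c a.
    split; last by apply/eqP; rewrite eq_le U1 -lerN2 U2.
    by apply: subset_closure; apply: ballO; rewrite subrr enorm0 ltW.
  by rewrite lev /sphere/= subrr enorm0 => r00; move: r0; rewrite -r00 ltxx.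
(* The body is convex, contains [y0] in the open ball and misses the sphere, so it cannot cross
   it. *)
have inK y : ~ Omega y -> enorm (y - a) < r.
  move=> Ky; rewrite ltNge; apply/negP => ry.
  pose g t := enorm (y0 + t *: (y - y0) - a).
  have cg : {within `[0, 1], continuous g}.
    apply: continuous_subspaceT => t.
    exact: (continuous_comp (@line_continuous R y0 (y - y0) t) (@enorm_continuous R a _)).
  have g0 : g 0 = enorm (y0 - a) by rewrite /g scale0r addr0.
  have g1 : g 1 = enorm (y - a) by rewrite /g scale1r [y0 + _]addrC subrK.
  have [|t] := @IVT R g 0 1 r ler01 cg.
    by rewrite g0 g1 ge_min (ltW y0r)/= le_max ry orbT.
  rewrite in_itv/= => t01 /sO[Ot _].
  exact: (convex_body_line bK Ky0 Ky t01).
have outO x : r <= enorm (x - a) -> Omega x.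
  by move=> rx; apply: contrapT => /inK; rewrite ltNge rx.
pose w x := U x - c * r * (enorm (x - a))^-1.
have hw x : Omega x -> x != a -> harmonic_at w x.
  move=> Ox xa; apply: harmonic_atB; first exact: hU.
  by apply: harmonic_atZ; exact: harmonic_at_inv_enorm.
have hwr x : r <= enorm (x - a) -> harmonic_at w x.
  move=> rx; apply: hw; first exact: outO.
  by apply: contraTneq rx => ->; rewrite subrr enorm0 -ltNge.
have wr x : enorm (x - a) = r -> w x = 0.
  by move=> xr; rewrite /w (sO _ xr).2 xr mulfK ?subrr// gt_eqF.
have woo (e : R) : 0 < e -> exists N : R, forall x, N <= enorm (x - a) -> `|w x| <= e.
  move=> e0; pose A := `|kappa| + `|c * r| + 1.
  have A0 : 0 < A by rewrite ltr_wpDl// addr_ge0.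
  exists (M + enorm a + A / e + 1) => x xN.
  have Ae0 : 0 < A / e by rewrite divr_gt0.
  have ea := enorm_ge0 a.
  have xa0 : A / e < enorm (x - a) by lra.
  have tri : enorm (x - a) <= enorm x + enorm a by rewrite -(enormN a) enormD.
  have xM : M < enorm x by lra.
  have x0 : A / e < enorm x by lra.
  have /andP[Ux0 Uxk] := UM _ xM.
  have xp : 0 < enorm x by exact: lt_trans Ae0 x0.
  have xap : 0 < enorm (x - a) by exact: lt_trans Ae0 xa0.
  rewrite (le_trans (ler_normB _ _))// (gtr0_norm Ux0).
  have h1 : U x <= `|kappa| * (e / A).
    rewrite (le_trans Uxk)// (le_trans (ler_norm _))// normrM normfV (gtr0_norm xp).
    by rewrite ler_wpM2l// -[e / A]invf_div lef_pV2 ?posrE ?divr_gt0// ltW.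
  have h2 : `|c * r / enorm (x - a)| <= `|c * r| * (e / A).
    rewrite normrM normfV (gtr0_norm xap).
    by rewrite ler_wpM2l// -[e / A]invf_div lef_pV2 ?posrE ?divr_gt0// ltW.
  rewrite (le_trans (lerD h1 h2))// -mulrDl mulrA ler_pdivrMr// mulrC ler_wpM2l ?(ltW e0)//.
  by rewrite /A lerDl.
have w0 x : r <= enorm (x - a) -> w x = 0.
  move=> rx; apply/eqP; rewrite eq_le; apply/andP; split.
    apply: (exterior_maximum hwr _ _ rx) => [y /wr->//|e /woo[N HN]].
    by exists N => y /HN; apply: le_trans; exact: ler_norm.
  rewrite -oppr_le0; apply: (@exterior_maximum R a r (fun y => - w y) _ _ _ x rx).
  - by move=> y /hwr; exact: harmonic_atN.
  - by move=> y /wr->; rewrite oppr0.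
  - move=> e /woo[N HN]; exists N => y /HN; apply: le_trans.
    by rewrite -normrN ler_norm.
(* The ray ends outside the ball, where [w] vanishes on an open set; unique continuation carries
   this back to [x]. The condition on [a] avoids the singularity of [w]. *)
have ray x v : v != 0 -> (forall t, 0 <= t -> Omega (x + t *: v) /\ x + t *: v != a) -> w x = 0.
  move=> v0 xv; have v0' := enorm_gt0 v0.
  pose T := (r + 1 + enorm (x - a)) / enorm v.
  have rT0 : 0 <= r + 1 + enorm (x - a).
    by rewrite addr_ge0 ?enorm_ge0// addr_ge0// ltW.
  have T0 : 0 <= T by rewrite divr_ge0// ltW.
  pose D := Omega `&` [set y | 0 < enorm (y - a)].
  have oD : open D by apply: openI => //; exact: open_enorm_gt.
  have Ta : r < enorm (x + T *: v - a).
    have := enorm_triangle (T *: v) (a - x) 0.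
    rewrite !subr0 opprB addrA [T *: v + x]addrC enormZ ger0_norm// /T divfK ?gt_eqF//.
    by rewrite [enorm (a - x)]enormB; lra.
  apply: (@unique_continuation R D [set x + t *: v | t in `[0, T]] w (x + T *: v) oD).
  - move=> y [Oy /= ya]; apply: hw => //.
    by apply: contraTneq ya => ->; rewrite subrr enorm0 ltxx.
  - exact: connected_segment.
  - move=> y [t /=]; rewrite in_itv/= => /andP[t0 _] <-.
    by have [? ?] := xv _ t0; split => //=; rewrite enorm_gt0// subr_eq0.
  - by exists T => //=; rewrite in_itv/= T0 lexx.
  - have : \forall y \near x + T *: v, r < enorm (y - a).
      by apply: (open_nbhs_nbhs (conj (@open_enorm_gt _ a r) _)).
    by apply: filterS => y /ltW/w0.
  - by exists 0; rewrite ?scale0r ?addr0//= in_itv/= lexx.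
have c0 : c != 0.
  pose s := r + M + enorm a + 1; have ea := enorm_ge0 a.
  pose x : V := a + s *: delta_mx 0 0.
  have s0 : 0 < s by rewrite /s; lra.
  have d1 : enorm (delta_mx 0 0 : V) = 1 by rewrite /enorm dot_delta mxE eqxx sqrtr1.
  have xa : enorm (x - a) = s by rewrite /x addrC addKr enormZ d1 mulr1 gtr0_norm.
  have tri : enorm (x - a) <= enorm x + enorm a by rewrite -(enormN a) enormD.
  have /UM/andP[Ux0 _] : M < enorm x by move: tri; rewrite xa /s; lra.
  have /w0/eqP : r <= enorm (x - a) by rewrite xa /s; lra.
  rewrite /w subr_eq0 => /eqP Ux; apply: contraTneq Ux0 => c0.
  by rewrite Ux c0 !mul0r ltxx.
(* Otherwise [U] equals c r / |x - a| on the ray leaving [a] away from [y0], and is unbounded near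
   [a], against its continuity there. *)
have aK : ~ Omega a.
  move=> Oa; pose v := a - y0.
  have v0 : v != 0.
    by rewrite subr_eq0; apply/eqP => E; apply: Ky0; rewrite -E.
  have v0' := enorm_gt0 v0.
  have Us (s : R) : 0 < s -> U (a + s *: v) = c * r / (s * enorm v).
    move=> s0; have : w (a + s *: v) = 0.
      apply: (@ray _ v v0) => t t0; rewrite -addrA -scalerDl; split.
        by apply: convex_exterior_ray => //; rewrite addr_ge0// ltW.
      rewrite -subr_eq0 [a + _]addrC addrK scaler_eq0 negb_or v0 andbT.
      by rewrite gt_eqF// ltr_wpDr.
    move/eqP; rewrite /w subr_eq0 => /eqP ->.
    by rewrite addrC addKr enormZ gtr0_norm.
  have [cUa _] := hU _ Oa.
  have [d d0 Hd] := (near_normP _ _).1 (@cvgr_dist_lt _ _ _ (nbhs a) _ _ _ cUa _ ltr01).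
  have nv : 0 < `|v| by rewrite normr_gt0.
  pose B := `|U a| + 1; have B0 : 0 < B by rewrite ltr_wpDl.
  have cr0 : 0 < `|c * r| by rewrite normr_gt0 mulf_neq0// gt_eqF.
  (* The first bound keeps the point near [a], where |U| < B; the second makes |c r| / (s |v|) at
     least 2 B. *)
  pose s := Num.min (d / (2 * `|v|)) (`|c * r| / (2 * B * enorm v)).
  have s0 : 0 < s by rewrite lt_min !divr_gt0// !mulr_gt0.
  have /Hd : `|a + s *: v - a| < d.
    rewrite addrC addKr normrZ gtr0_norm//.
    apply: (@le_lt_trans _ _ (d / (2 * `|v|) * `|v|)).
      by rewrite ler_wpM2r// ge_min lexx.
    have -> : d / (2 * `|v|) * `|v| = d / 2 by field; rewrite gt_eqF.
    by rewrite ltr_pdivrMr// ltr_pMr// ltr1n.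
  rewrite Us// => H.
  have : `|c * r / (s * enorm v)| < B.
    rewrite -[X in `|X|](subKr (U a)) (le_lt_trans (ler_normB _ _))// /B ltrD2l//.
  rewrite normrM normfV [`|s * _|]gtr0_norm ?mulr_gt0// ltr_pdivrMr ?mulr_gt0//.
  have : s <= `|c * r| / (2 * B * enorm v) by rewrite ge_min lexx orbT.
  rewrite ler_pdivlMr ?mulr_gt0// => h1 h2.
  suff : `|c * r| <= 0 by rewrite leNgt cr0.
  have : B * (s * enorm v) = (s * (2 * B * enorm v)) / 2 by field.
  by lra.
(* The denominator is cleared because the identity is to be extended to the boundary, where x = a is
   not yet excluded. *)
have wO x : Omega x -> U x * enorm (x - a) - c * r = 0.
  move=> Ox; have xa : x - a != 0.
    by rewrite subr_eq0; apply/eqP => E; apply: aK; rewrite -E.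
  have : w x = 0.
    apply: (@ray _ (x - a) xa) => t t0.
    have Ot := convex_exterior_ray bK Ox aK t0.
    by split => //; apply/eqP => E; apply: aK; rewrite -E.
  rewrite /w => /eqP; rewrite subr_eq0 => /eqP ->.
  by rewrite mulfVK ?subrr// gt_eqF// enorm_gt0.
have kE x : bdry Omega x -> k * enorm (x - a) = c * r.
  move=> bx; rewrite -(Uk _ bx); apply/eqP; rewrite -subr_eq0; apply/eqP.
  have cw : {within closure Omega, continuous (fun x => U x * enorm (x - a) - c * r)}.
    apply/subspace_continuousP => y cly; apply: cvgB; last exact: cvg_cst.
    apply: cvgM; first by move/subspace_continuousP: cU; exact.
    by apply: cvg_within_filter; exact: enorm_continuous.
  by apply: (continuous_closure_eq0 cw wO); case: bx.
have [b bb] := bdry_nonempty oO bK.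
have cr0 : c * r != 0 by rewrite mulf_neq0// gt_eqF.
have k0 : k != 0 by apply: contra cr0 => /eqP k0; rewrite -(kE _ bb) k0 mul0r.
exists a, (enorm (b - a)); split.
  rewrite lt_neqAle enorm_ge0 andbT eq_sym; apply: contra cr0 => /eqP b0.
  by rewrite -(kE _ bb) b0 mulr0.
apply: bdry_eq_sphere => [|x bx].
  rewrite lt_neqAle enorm_ge0 andbT eq_sym; apply: contra cr0 => /eqP b0.
  by rewrite -(kE _ bb) b0 mulr0.
by apply: (mulfI k0); rewrite !kE.
Qed.

End exterior_problem.

(** * The interior problem *)

Section interior_tools.
Variable R : realType.
Local Notation V := 'rV[R]_3.
Implicit Types (f : V -> R) (x p v w : V) (A C : set V).

Lemma within_normP A x (P : set V) : (\forall y \near within A (nbhs x), P y) <->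
  exists2 d : R, 0 < d & forall y, A y -> `|y - x| < d -> P y.
Proof.
split=> [H|[d d0 H]].
  have [d d0 Hd] := (near_normP x (fun y => A y -> P y)).1 H.
  by exists d => // y Ay yx; exact: Hd.
by apply: (near_normP x (fun y => A y -> P y)).2; exists d => // y yx Ay; exact: H.
Qed.

Lemma compact_within_preimage C f (F : set R) : compact C -> {within C, continuous f} ->
  closed F -> compact (C `&` f @^-1` F).
Proof.
move=> cC /subspace_continuousP cf clF.
have clC : closed C by apply: compact_closed => //; exact: norm_hausdorff.
apply: (subclosed_compact _ cC); last by move=> x [].
move=> x clx; have Cx : C x by apply: clC; apply: closure_subset clx => y [].
split => //; apply: contrapT => nF.
have nF' : nbhs (f x) (~` F).
  by apply: open_nbhs_nbhs; split => //; exact: closed_openC.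
have H : \forall y \near within C (nbhs x), (~` F) (f y) by exact: (cf _ Cx _ nF').
by have [y [[Cy Fy]]] := clx _ H; exact.
Qed.

Lemma dot_continuous w : continuous (fun x => dot x w).
Proof.
have c (i : 'I_3) : continuous (fun x : V => x 0 i * w 0 i).
  move=> x; exact: (continuousM (@coord_continuous R 1 3 0 i x) (@cst_continuous V R _ x)).
rewrite (_ : (fun x => _) = fun x => x 0 0 * w 0 0 + x 0 1 * w 0 1 + x 0 2%:R * w 0 2%:R).
  move=> x; exact: (continuousD (continuousD (c 0 x) (c 1 x)) (c 2%:R x)).
by apply/funext => x; rewrite dotE.
Qed.

Lemma grad_limit_dot_gt A f p v w (m : R) :
  grad f x @[x --> within A (nbhs p)] --> v -> m < dot v w ->
  exists2 d : R, 0 < d & forall y, A y -> `|y - p| < d -> m < dot (grad f y) w.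
Proof.
move=> gv mv; apply/within_normP.
have dv : dot (grad f x) w @[x --> within A (nbhs p)] --> dot v w.
  exact: (cvg_comp _ _ gv (@dot_continuous w v)).
exact: (cvgr_gt _ dv).
Qed.

(* To first order in l, the radial comparison function grows by at most
   l C k / rho^2 along a path of length l C ending at distance rho. *)
Lemma radial_growth (k C rho m : R) : 0 < k -> 0 < C -> 0 < rho ->
  C * (k / rho ^+ 2) < m ->
  exists2 l0 : R, 0 < l0 & forall l, 0 < l < l0 ->
    exists2 eta0 : R, 0 < eta0 <= m * l & forall eta Y, 0 < eta < eta0 -> 0 < Y ->
      rho - l * C - eta <= Y -> k * (Y^-1 - rho^-1) < m * l - eta.
Proof.
move=> k0 C0 rho0 mk.
have m0 : 0 < m by apply: lt_trans mk; rewrite mulr_gt0// divr_gt0// exprn_gt0.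
pose gam := m * rho / k - C / rho.
have gam0 : 0 < gam.
  rewrite subr_gt0 ltr_pdivlMr// mulrAC ltr_pdivrMr// -mulrA -expr2.
  by rewrite -ltr_pdivrMr ?exprn_gt0// -mulrA.
have Cmk : 0 < C * m / k by rewrite divr_gt0// mulr_gt0.
exists (gam / (C * m / k)); first exact: divr_gt0.
move=> l /andP[l0]; rewrite ltr_pdivlMr// => lgam.
(* The goal says 1 / Y < b - eta / k, and Y >= a - eta, so it suffices that (a - eta) (b - eta / k)
   > 1. Here a b - 1 is [gam] times l up to a term in l^2, and the bounds on eta keep the product
   above 1. *)
pose a := rho - l * C; pose b := rho^-1 + m * l / k.
have ml0 : 0 < m * l by rewrite mulr_gt0.
have ab : 1 < a * b.
  have -> : a * b = 1 + l * (gam - l * (C * m / k)).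
    by rewrite /a /b /gam; field; rewrite !gt_eqF.
  by rewrite ltrDl mulr_gt0// subr_gt0.
have b0 : 0 < b by rewrite addr_gt0 ?invr_gt0// divr_gt0.
have a0 : 0 < a by rewrite -(pmulr_lgt0 _ b0); exact: lt_trans ab.
have abk : 0 < b + a / k by rewrite addr_gt0// divr_gt0.
exists (Num.min (m * l) (Num.min a ((a * b - 1) / (b + a / k)))).
  by rewrite !lt_min ml0 a0 ge_min lexx divr_gt0 ?subr_gt0.
move=> eta Y /andP[eta0]; rewrite !lt_min => /and3P[eta1 eta2].
rewrite ltr_pdivlMr// => eta3 Y0 aY; rewrite ltNge; apply/negP.
rewrite -ler_pdivrMl// [k^-1 * _]mulrC lerBrDr => H.
have bk : 0 < b - eta / k.
  have : eta / k <= m * l / k by rewrite ler_pM2r ?invr_gt0// ltW.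
  have : 0 < rho^-1 by rewrite invr_gt0.
  by rewrite /b; lra.
have HY : (b - eta / k) * Y <= 1.
  rewrite -ler_pdivlMr// mul1r (le_trans _ H)// /b mulrBl; lra.
have HP : (b - eta / k) * (a - eta) <= 1.
  by rewrite (le_trans _ HY)// ler_wpM2l// ltW.
have h2 : 0 <= eta ^+ 2 / k by rewrite divr_ge0 ?sqr_ge0// ltW.
have : (b - eta / k) * (a - eta) = a * b - eta * (b + a / k) + eta ^+ 2 / k.
  by field; rewrite gt_eqF.
lra.
Qed.

End interior_tools.

(** * Positivity and level sets of the Green function *)

Section interior_problem.
Variables (R : realType) (Omega : set 'rV[R]_3) (G : 'rV[R]_3 -> R) (kappa c C : R).
Local Notation V := 'rV[R]_3.
Hypotheses (oO : open Omega) (bK : convex_body (~` Omega)) (pole : ~ closure Omega 0).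
(** [A] is the open body without the pole, where G is harmonic; [K'] is the closed body without the
    pole, where G is continuous. *)
Local Notation A := (~` (closure Omega `|` [set 0])).
Local Notation K' := (~` (Omega `|` [set 0])).
Hypotheses (hG : forall x, A x -> harmonic_at G x) (G1 : Ck_on 1 A G)
  (cG : {within K', continuous G}) (G0 : forall x, bdry Omega x -> G x = 0).
Hypotheses (kappa0 : 0 < kappa)
  (sing : forall e : R, 0 < e -> exists2 d : R, 0 < d & forall x, x != 0 ->
     enorm x < d -> (1 - e) * kappa / enorm x <= G x <= (1 + e) * kappa / enorm x).
Implicit Types x y v w : V.

Let interior_compl x : interior (~` Omega) x <-> ~ closure Omega x.
Proof. by rewrite interiorC. Qed.

Let intK x : interior (~` Omega) x -> ~ Omega x.
Proof. exact: interior_subset. Qed.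

Let int0 : interior (~` Omega) (0 : V).
Proof. exact/interior_compl. Qed.

Let AP x : A x <-> interior (~` Omega) x /\ x <> 0.
Proof. by rewrite interior_compl /= not_orP. Qed.

Let KP x : K' x <-> ~ Omega x /\ x <> 0.
Proof. by rewrite /= not_orP. Qed.

Let AK x : A x -> K' x.
Proof. by move=> /AP[/interior_subset Kx x0]; apply/KP. Qed.

Let oA : open A.
Proof.
apply: closed_openC; apply: closedU; first exact: closed_closure.
by apply: accessible_closed_set1; apply: hausdorff_accessible; exact: norm_hausdorff.
Qed.

Let G_bdry x : ~ Omega x -> ~ interior (~` Omega) x -> G x = 0.
Proof. by move=> Kx nKx; apply: G0; rewrite bdry_openE. Qed.

Let K0 : ~ Omega (0 : V).
Proof. exact: interior_subset int0. Qed.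

(** Lets a small ball around the pole be cut out, which leaves a compact set on which the maximum
    principle applies. *)
Lemma green_gt_near_pole (m : R) :
  exists2 d : R, 0 < d & forall x, x != 0 -> enorm x < d -> m < G x.
Proof.
have h0 : 0 < 2^-1 :> R by rewrite invr_gt0.
have [d d0 Hd] := sing h0.
pose M := `|m| + 1; have M0 : 0 < M by rewrite ltr_wpDl.
exists (Num.min d (2^-1 * kappa / M)).
  by rewrite lt_min d0 divr_gt0// mulr_gt0.
move=> x x0; rewrite lt_min => /andP[xd xM].
have ex := enorm_gt0 x0; have /andP[+ _] := Hd _ x0 xd; apply: lt_le_trans.
have -> : 1 - 2^-1 = 2^-1 :> R by field.
rewrite ltr_pdivlMr//; move: xM; rewrite ltr_pdivlMr// mulrC; apply: le_lt_trans.
by rewrite ler_wpM2r ?(ltW ex)// /M; have := ler_norm m; lra.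
Qed.

Let clK : compact (~` Omega). Proof. by case: bK. Qed.

Let compact_away (d : R) : 0 < d ->
  compact [set x | ~ Omega x /\ d <= enorm x] /\ [set x | ~ Omega x /\ d <= enorm x] `<=` K'.
Proof.
move=> d0; split=> [|x [Kx dx]]; last first.
  by apply/KP; split => // x0; move: dx; rewrite x0 enorm0 leNgt d0.
have -> : [set x | ~ Omega x /\ d <= enorm x] =
    ~` Omega `&` [set x | d <= enorm (x - 0)].
  by apply/seteqP; split => x /=; rewrite subr0.
apply: compact_closedI => //.
apply: (@closed_comp _ _ (fun x : V => enorm (x - 0)) [set y | d <= y]) => [x _|].
  exact: enorm_continuous.
exact: closed_ge.
Qed.

Let cvg_inv_enorm (k : R) : {within K', continuous (fun x : V => k * (enorm (x - 0))^-1)}.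
Proof.
apply/subspace_continuousP => x /KP[_ /eqP x0].
apply: cvgM; first exact: cvg_cst.
apply: cvgV; first by rewrite subr0 gt_eqF// enorm_gt0.
by apply: cvg_within_filter; exact: enorm_continuous.
Qed.

Let harmonic_inv (k : R) x : x <> 0 ->
  harmonic_at (fun x : V => k * (enorm (x - 0))^-1) x.
Proof. by move=> /eqP x0; apply: harmonic_atZ; exact: harmonic_at_inv_enorm. Qed.

Let open_away (d : R) : 0 < d -> open [set x | interior (~` Omega) x /\ d < enorm x].
Proof.
move=> d0; have -> : [set x | interior (~` Omega) x /\ d < enorm x] =
    interior (~` Omega) `&` [set x | d < enorm (x - 0)].
  by apply/seteqP; split => x /=; rewrite subr0.
by apply: openI; [exact: open_interior | exact: open_enorm_gt].
Qed.

Let away_A (d : R) x : 0 < d -> interior (~` Omega) x -> d < enorm x -> A x.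
Proof.
by move=> d0 Kx dx; apply/AP; split => // x0; move: dx; rewrite x0 enorm0 ltNge ltW.
Qed.

Lemma green_ge0 x : K' x -> 0 <= G x.
Proof.
move=> /KP[Kx /eqP x0]; have [d d0 Hd] := green_gt_near_pole 0.
have ex := enorm_gt0 x0.
pose s := Num.min (d / 2) (enorm x).
have s0 : 0 < s by rewrite lt_min divr_gt0.
have sd : s < d.
  by rewrite gt_min; apply/orP; left; rewrite ltr_pdivrMr// ltr_pMr// ltr1n.
have [cC CK'] := compact_away s0.
rewrite -oppr_le0; apply: (weak_maximum_principle (u := fun y => - G y) cC _
    (open_away s0)).
- apply: (@continuous_subspaceW _ _ _ K') => //.
  by move=> y; apply: continuousN; exact: cG.
- by move=> y [/interior_subset Ky /ltW].
- by move=> y [Ky sy]; have [_] := harmonic_atN (hG (away_A s0 Ky sy)).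
- move=> y [Ky sy] nD; rewrite oppr_le0.
  have y0 : y != 0 by apply: contraTneq sy => ->; rewrite enorm0 -ltNge.
  have [Iy|nIy] := pselect (interior (~` Omega) y); last by rewrite G_bdry.
  apply/ltW/Hd => //; rewrite (le_lt_trans _ sd)// leNgt; apply/negP => sy'.
  exact: nD.
- by split; [|rewrite ge_min lexx orbT].
Qed.

Hypotheses (lev0 : equipotential K' G c !=set0)
  (gradC : forall x, equipotential K' G c x ->
     exists2 v, grad G y @[y --> within A (nbhs x)] --> v & enorm v = C).

Let c0 : 0 <= c.
Proof. by have [x [K'x <-]] := lev0; exact: green_ge0. Qed.

Let level_compact : compact (equipotential K' G c).
Proof.
have [d d0 Hd] := green_gt_near_pole c.
have [cC CK'] := compact_away d0.
have -> : equipotential K' G c =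
    [set x | ~ Omega x /\ d <= enorm x] `&` G @^-1` [set c].
  apply/seteqP; split => [x [K'x Gx]|x [Cx Gx]]; last by split => //; exact: CK'.
  split => //; have /KP[Kx /eqP x0] := K'x; split => //.
  by rewrite leNgt; apply/negP => /(Hd _ x0); rewrite Gx ltxx.
apply: compact_within_preimage => //.
exact: continuous_subspaceW cG.
Qed.

Let level_continuous : {within equipotential K' G c, continuous (fun x : V => enorm (x - 0))}.
Proof. by apply: continuous_subspaceT => x; exact: enorm_continuous. Qed.

Let segK x (t : R) : ~ Omega x -> 0 <= t <= 1 -> ~ Omega (t *: x).
Proof.
move=> Kx t01; have := convex_body_line bK K0 Kx t01.
by rewrite add0r subr0.
Qed.

Let segI x (t : R) : ~ Omega x -> 0 <= t < 1 -> interior (~` Omega) (t *: x).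
Proof.
move=> Kx t01; have := convex_body_interior_line bK int0 Kx t01.
by rewrite add0r subr0.
Qed.

(** By convexity the segment from the pole to [x] lies in the body. G is large at one end and at
    most [c] at the other, so the level is met in between. *)
Lemma level_on_ray x : K' x -> G x <= c ->
  exists t : R, 0 < t <= 1 /\ equipotential K' G c (t *: x).
Proof.
move=> /KP[Kx /eqP x0] Gx; have [d d0 Hd] := green_gt_near_pole c.
have ex := enorm_gt0 x0.
pose s := Num.min 1 (d / (2 * enorm x)).
have s0 : 0 < s by rewrite lt_min ltr01 divr_gt0// mulr_gt0.
have s1 : s <= 1 by rewrite ge_min lexx.
have K't (t : R) : s <= t <= 1 -> K' (t *: x).
  move=> /andP[st t1]; have t0 := lt_le_trans s0 st; apply/KP; split.
    by apply: segK => //; rewrite (ltW t0).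
  by apply/eqP; rewrite scaler_eq0 negb_or x0 gt_eqF.
have Gs : c < G (s *: x).
  apply: Hd; first by rewrite scaler_eq0 negb_or x0 gt_eqF.
  rewrite enormZ gtr0_norm//.
  apply: (@le_lt_trans _ _ (d / (2 * enorm x) * enorm x)).
    by rewrite ler_wpM2r ?(ltW ex)// ge_min lexx orbT.
  have -> : d / (2 * enorm x) * enorm x = d / 2 by field; rewrite gt_eqF.
  by rewrite ltr_pdivrMr// ltr_pMr// ltr1n.
have cg : {within `[s, 1], continuous (fun t => G (t *: x))}.
  apply/subspace_continuousP => t; rewrite /= in_itv/= => t01.
  move/subspace_continuousP: cG => /(_ _ (K't _ t01)) Gt.
  apply: cvg_trans Gt => P /within_normP[e e0 He].
  have nc := @scalel_continuous R V x t.
  have Hn : nbhs (t *: x) [set y | `|y - t *: x| < e].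
    by apply: (near_normP _ (fun y => `|y - t *: x| < e)).2; exists e.
  move: (nc _ Hn); apply: (@filterS _ (nbhs t)) => u ut /=; rewrite in_itv/= => u01.
  exact: He (K't _ u01) ut.
have [|t] := @IVT R _ s 1 c s1 cg.
  by rewrite scale1r ge_min Gx orbT/= le_max (ltW Gs).
rewrite in_itv/= => t01 Gt; exists t; split.
  by case/andP: t01 => st ->; rewrite andbT (lt_le_trans s0).
by split => //; exact: K't.
Qed.

(** * Comparison with the inner and the outer ball of the level set *)

Section extremal_radii.
Variables (r Rm : R).
Hypotheses (r0 : 0 < r) (lev_ge : forall x, equipotential K' G c x -> r <= enorm x)
  (lev_le : forall x, equipotential K' G c x -> enorm x <= Rm).

Lemma sublevel_ge x : K' x -> G x <= c -> r <= enorm x.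
Proof.
move=> K'x Gx; have [t [/andP[t0 t1] lt]] := level_on_ray K'x Gx.
apply: (le_trans (lev_ge lt)); rewrite enormZ gtr0_norm//.
by rewrite ler_piMl// enorm_ge0.
Qed.

Lemma strict_sublevel_gt x : K' x -> G x < c -> r < enorm x.
Proof.
move=> K'x Gx; have /KP[_ /eqP x0] := K'x.
have [t [/andP[t0 t1] lt]] := level_on_ray K'x (ltW Gx).
apply: (le_lt_trans (lev_ge lt)); rewrite enormZ gtr0_norm//.
rewrite gtr_pMl ?enorm_gt0// lt_neqAle t1 andbT.
apply: contraTneq Gx => t1'; case: lt; rewrite t1' scale1r => _ ->.
by rewrite ltxx.
Qed.

(** At the exit point G = 0 <= c, so this point is at distance at least [r]: the ball of radius [r]
    lies in the body. *)
Let exit0 x : x != 0 -> exists T : R, [/\ 0 < T, r <= T * enorm x,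
  ~ Omega (T *: x) & forall t, 0 <= t < T -> interior (~` Omega) (t *: x)].
Proof.
move=> x0; have [T [T0 KT nKT HT]] := convex_body_exit bK int0 x0.
have {nKT} GT := G_bdry KT nKT; rewrite add0r in KT GT.
exists T; split; [exact: T0| |exact: KT|by move=> t /HT; rewrite add0r].
have := @sublevel_ge (T *: x); rewrite enormZ (gtr0_norm T0); apply; last by rewrite GT.
apply/KP; split; first exact: KT.
by apply/eqP; rewrite scaler_eq0 negb_or x0 gt_eqF.
Qed.

Lemma inner_ball_interior x : x <> 0 -> enorm x < r -> A x.
Proof.
move=> /eqP x0 xr; have [T [T0 rT _ HT]] := exit0 x0; apply/AP; split; last exact/eqP.
have := HT 1; rewrite scale1r; apply; rewrite ler01/= ltNge; apply/negP => T1.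
by have := lt_le_trans xr rT; rewrite ltNge ler_piMl ?enorm_ge0.
Qed.

Lemma inner_ball_closed x : x <> 0 -> enorm x <= r -> K' x /\ c <= G x.
Proof.
move=> x0 xr; have K'x : K' x.
  have /eqP x0' := x0; have [T [T0 rT KT _]] := exit0 x0'; apply/KP; split => //.
  have T1 : 1 <= T.
    by have := le_trans xr rT; rewrite -[leLHS]mul1r ler_pM2r// enorm_gt0.
  have -> : x = T^-1 *: (T *: x) by rewrite scalerA mulVf ?scale1r// gt_eqF.
  by apply: segK => //; rewrite invr_ge0 (ltW T0)/= invf_le1.
split => //; rewrite leNgt; apply/negP => /(strict_sublevel_gt K'x).
by rewrite ltNge xr.
Qed.

Lemma inner_ball_gt x : x <> 0 -> enorm x < r -> c < G x.
Proof.
move=> x0 xr; rewrite ltNge; apply/negP.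
move=> /(sublevel_ge (AK (inner_ball_interior x0 xr))).
by rewrite leNgt xr.
Qed.

(** The comparisons near the pole sacrifice a factor 1 - e to absorb the error of the asymptotics;
    this removes it. *)
Let le_eps (a b : R) : (forall e, 0 < e -> e < 1 -> (1 - e) * a <= b) -> a <= b.
Proof.
move=> H; apply/ler_addgt0Pr => e e0.
pose M := `|a| + 1 + e; have M0 : 0 < M by rewrite addr_gt0// ltr_wpDl.
have h : 0 < e / M by rewrite divr_gt0.
have h1 : e / M < 1 by rewrite ltr_pdivrMr// mul1r /M ltrDr ltr_wpDl.
have := H _ h h1; rewrite mulrBl mul1r lerBlDr => /le_trans; apply; rewrite lerD2l.
rewrite mulrAC ler_pdivrMr// ler_pM2l// /M (le_trans (ler_norm _))// -addrA lerDl.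
by rewrite addr_ge0// ltW.
Qed.

Lemma green_ge_radial x : x <> 0 -> enorm x <= r ->
  c + kappa * ((enorm x)^-1 - r^-1) <= G x.
Proof.
move=> /eqP x0 xr; rewrite addrC -lerBrDr; apply: le_eps => e e0 e1.
have e20 : 0 < e / 2 by rewrite divr_gt0.
have [d d0 Hd] := sing e20; have ex := enorm_gt0 x0.
have c1 : 0 < c + 1 by rewrite ltr_wpDl.
(* On |y| = s one has G >= (1 - e / 2) kappa / s. The spare half of e is worth e kappa / (2 s), and
   the last bound on [s] makes this at least [c], as the comparison on the inner sphere requires. *)
pose s := Num.min (enorm x) (Num.min (d / 2) (e / 2 * kappa / (c + 1))).
have s0 : 0 < s by rewrite !lt_min ex !divr_gt0//= mulr_gt0.
have sx : s <= enorm x by rewrite ge_min lexx.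
have sd : s < d.
  rewrite (@le_lt_trans _ _ (d / 2))//; first by rewrite !ge_min lexx orbT.
  by rewrite ltr_pdivrMr// ltr_pMr// ltr1n.
have sc : c <= e / 2 * kappa / s.
  have : s <= e / 2 * kappa / (c + 1) by rewrite !ge_min lexx !orbT.
  rewrite ler_pdivlMr// => H; rewrite ler_pdivlMr// mulrC.
  by rewrite (le_trans _ H)// ler_pM2l// lerDl.
pose u y := (1 - e) * kappa * (enorm (y - 0))^-1 - G y.
suff : u x <= (1 - e) * kappa / r - c by rewrite /u subr0; lra.
pose S := [set y : V | s <= enorm (y - 0) <= r].
pose D := [set y : V | s < enorm (y - 0) < r].
have S0 y : s <= enorm (y - 0) -> y <> 0.
  by rewrite subr0 => sy y0; move: sy; rewrite y0 enorm0 leNgt s0.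
have SK y : S y -> K' y.
  by move=> /andP[sy yr]; apply: (inner_ball_closed (S0 _ sy) _).1; rewrite subr0 in yr.
have DS : D `<=` S by move=> y /= /andP[sy yr]; rewrite /S/= !ltW.
apply: (weak_maximum_principle (u := u) (@compact_enorm_annulus _ 0 s r) _
    (@open_enorm_annulus _ 0 s r) DS).
- apply: (@continuous_subspaceW _ _ _ K') => //.
  exact: (within_continuousB (@cvg_inv_enorm ((1 - e) * kappa)) cG).
- move=> y Dy; have /andP[sy yr] := Dy; have y0 := S0 _ (ltW sy).
  rewrite subr0 in yr.
  have [] := harmonic_atB (harmonic_inv ((1 - e) * kappa) y0) (hG (inner_ball_interior y0 yr)).
  by [].
- move=> y Sy nD; have /andP[sy yr] := Sy; have y0 := S0 _ sy.
  rewrite /u; rewrite subr0 in sy yr *.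
  have [yr'|yr'] := ltP (enorm y) r; last first.
    have -> : enorm y = r by apply/eqP; rewrite eq_le yr yr'.
    by rewrite lerD2l lerN2; apply: (inner_ball_closed y0 yr).2.
  have ys : enorm y = s.
    apply/eqP; rewrite eq_le sy andbT leNgt; apply/negP => sy'.
    by apply: nD; rewrite /D/= subr0 sy' yr'.
  have /eqP y0' := y0.
  have yd : enorm y < d by rewrite ys.
  have /andP[Gy _] := Hd _ y0' yd; rewrite ys in Gy *.
  have : 0 <= (1 - e) * kappa / r.
    by rewrite divr_ge0 ?(ltW r0)// mulr_ge0 ?(ltW kappa0)// subr_ge0 ltW.
  have : (1 - e / 2) * kappa / s = (1 - e) * kappa / s + e / 2 * kappa / s.
    by field; rewrite gt_eqF.
  lra.
- by rewrite /= subr0 sx.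
Qed.

Hypothesis Rm0 : 0 < Rm.

(** The outer ball need not lie in the body, so the comparison takes place where G >= c. Away from
    the small sphere, the boundary of this region consists of level points, which are within [Rm] of
    the pole. *)
Lemma green_le_radial x : K' x -> c < G x ->
  G x <= c + kappa * ((enorm x)^-1 - Rm^-1).
Proof.
move=> K'x cx; have /KP[Kx /eqP x0] := K'x; rewrite addrC -lerBlDr.
apply: le_eps => e e0 e1.
have e20 : 0 < e / 2 by rewrite divr_gt0.
have [d d0 Hd] := sing e20; have ex := enorm_gt0 x0.
(* On |y| = s the factor (1 - e) (1 + e / 2) leaves a surplus of at least e kappa / (2 s), and the
   last bound makes it at least kappa / Rm. *)
pose s := Num.min (enorm x) (Num.min (d / 2) (e / 2 * Rm)).
have s0 : 0 < s by rewrite !lt_min ex !divr_gt0//= mulr_gt0.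
have sx : s <= enorm x by rewrite ge_min lexx.
have sd : s < d.
  rewrite (@le_lt_trans _ _ (d / 2))//; first by rewrite !ge_min lexx orbT.
  by rewrite ltr_pdivrMr// ltr_pMr// ltr1n.
have sR : kappa / Rm <= e / 2 * kappa / s.
  rewrite ler_pdivlMr// mulrAC ler_pdivrMr// mulrAC [leRHS]mulrC ler_pM2l//.
  by rewrite !ge_min lexx !orbT.
have [cC CK'] := compact_away s0.
have cS := compact_within_preimage cC (continuous_subspaceW CK' cG) (@closed_ge _ c).
pose D := [set y | interior (~` Omega) y /\ s < enorm y] `&` G @^-1` [set z | c < z].
pose u y := (1 - e) * G y - kappa * (enorm (y - 0))^-1.
suff : u x <= (1 - e) * c - kappa / Rm by rewrite /u subr0; lra.
have DA y : D y -> A y by move=> [[Iy sy] _]; exact: away_A Iy sy.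
apply: (weak_maximum_principle (u := u) (D := D) cS).
- apply: (@continuous_subspaceW _ _ _ K'); first by move=> y [/CK'].
  have cGe : {within K', continuous (fun y => (1 - e) * G y)}.
    apply/subspace_continuousP => y K'y; apply: cvgM; first exact: cvg_cst.
    by move/subspace_continuousP: cG; exact.
  exact: (within_continuousB cGe (@cvg_inv_enorm kappa)).
- rewrite openE => y Dy; have [[Iy sy] cy] := Dy.
  have [cGy _] := hG (DA _ Dy).
  apply: filterI; first by apply: open_nbhs_nbhs; split; [exact: open_away | split].
  by apply: cGy; apply: open_nbhs_nbhs; split => //; exact: open_gt.
- by move=> y [[/interior_subset Iy /ltW sy] /ltW cy].
- move=> y Dy; have Ay := DA _ Dy; have /AP[_ y0] := Ay.
  by have [] := harmonic_atB (harmonic_atZ (1 - e) (hG Ay)) (harmonic_inv kappa y0).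
- move=> y [[Ky sy] cy] nD; rewrite /= in cy.
  have y0 : y != 0 by apply: contraTneq sy => ->; rewrite enorm0 -ltNge.
  have ey := enorm_gt0 y0; have K'y : K' y by apply/KP; split => //; exact/eqP.
  rewrite /u subr0; have [cy'|cy'] := leP (G y) c.
    have Gy : G y = c by apply/eqP; rewrite eq_le cy' cy.
    by rewrite Gy lerD2l lerN2 ler_pM2l// lef_pV2 ?posrE//; apply: lev_le.
  have Iy : interior (~` Omega) y.
    by apply: contrapT => nIy; move: cy'; rewrite G_bdry// ltNge c0.
  have ys : enorm y = s.
    apply/eqP; rewrite eq_le sy andbT leNgt; apply/negP => sy'; exact: nD.
  have yd : enorm y < d by rewrite ys.
  have /andP[_ Gy] := Hd _ y0 yd; rewrite ys in Gy *.
  have h1 : (1 - e) * G y <= (1 - e) * ((1 + e / 2) * kappa / s).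
    by rewrite ler_wpM2l// subr_ge0 ltW.
  have h2 : 0 <= (1 - e) * c by rewrite mulr_ge0// subr_ge0 ltW.
  have ks : 0 <= e ^+ 2 * (kappa / s) by rewrite mulr_ge0 ?sqr_ge0// divr_ge0// ltW.
  have : (1 - e) * ((1 + e / 2) * kappa / s) =
     kappa / s - e / 2 * kappa / s - e ^+ 2 * (kappa / s) / 2 by field; rewrite gt_eqF.
  lra.
- by split; [split | exact: ltW].
Qed.

Let line_K'_continuous x v (T : R) : (forall t, 0 <= t <= T -> K' (x + t *: v)) ->
  {within `[0, T], continuous (fun t => G (x + t *: v))}.
Proof.
move=> K't; apply/subspace_continuousP => t; rewrite /= in_itv/= => t01.
move/subspace_continuousP: cG => /(_ _ (K't _ t01)) Gt.
apply: cvg_trans Gt => P /within_normP[e e0 He].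
have nc := @line_continuous R x v t.
have Hn : nbhs (x + t *: v) [set y | `|y - (x + t *: v)| < e].
  by apply: (near_normP _ (fun y => `|y - (x + t *: v)| < e)).2; exists e.
move: (nc _ Hn); apply: (@filterS _ (nbhs t)) => u ut /=; rewrite in_itv/= => u01.
exact: He (K't _ u01) ut.
Qed.

(** Otherwise G would grow at a rate below kappa / r along t |-> (1 - t) p near [p]. By
    [green_ge_radial] its growth up to T is at least kappa T / (r (1 - T)), a contradiction. *)
Lemma grad_lower p : equipotential K' G c p -> enorm p = r -> kappa / r ^+ 2 <= C.
Proof.
move=> lp pr; have [K'p Gp] := lp; have /KP[Kp /eqP p0] := K'p.
have [v gv vC] := gradC lp.
suff H : kappa / r <= dot v (- p).
  have := le_trans H (dot_le _ _); rewrite enormN pr vC.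
  by rewrite ler_pdivrMr// ler_pdivrMr ?exprn_gt0// -mulrA expr2.
rewrite leNgt; apply/negP => H.
have H' : - (kappa / r) < dot v p by rewrite dotNr in H; lra.
have [d d0 Hd] := grad_limit_dot_gt gv H'.
have np : 0 < `|p| by rewrite normr_gt0.
pose T := Num.min 2^-1 (d / (2 * `|p|)).
have T0 : 0 < T by rewrite lt_min invr_gt0 ltr0n/= divr_gt0// mulr_gt0.
have T1 : T < 1.
  by rewrite gt_min; apply/orP; left; rewrite invf_lt1// ltr1n.
have Td : T * `|p| < d.
  apply: (@le_lt_trans _ _ (d / (2 * `|p|) * `|p|)).
    by rewrite ler_wpM2r// ge_min lexx orbT.
  have -> : d / (2 * `|p|) * `|p| = d / 2 by field; rewrite gt_eqF.
  by rewrite ltr_pdivrMr// ltr_pMr// ltr1n.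
have pE (t : R) : p + t *: (- p) = (1 - t) *: p.
  by rewrite scalerN -scaleNr scalerDl scale1r.
have pt0 (t : R) : t < 1 -> (1 - t) *: p <> 0.
  by move=> t1; apply/eqP; rewrite scaler_eq0 negb_or p0 andbT gt_eqF// subr_gt0.
have Ap (t : R) : 0 < t < 1 -> A (p + t *: (- p)).
  move=> /andP[t0 t1]; rewrite pE; apply: inner_ball_interior; first exact: pt0.
  by rewrite enormZ gtr0_norm ?subr_gt0// pr gtr_pMl// gtrBl.
have [||t /andP[t0 tT]] := @line_MVT R A G p (- p) T oA G1 T0.
- by move=> t /andP[t0 tT]; apply: Ap; rewrite t0 (lt_trans tT).
- apply: line_K'_continuous => t /andP[]; rewrite le_eqVlt => /orP[/eqP<- _|t0 tT].
    by rewrite scale0r addr0.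
  by apply: AK; apply: Ap; rewrite t0 (le_lt_trans tT).
have AT := Ap T; rewrite T0 T1 in AT; have /AP[_ pT0] := AT isT.
have At := Ap t; rewrite t0 (lt_trans tT T1) in At.
have := green_ge_radial pT0; rewrite pE enormZ gtr0_norm ?subr_gt0// pr.
have T1' : 0 < 1 - T by rewrite subr_gt0.
rewrite ler_piMl ?(ltW r0) ?gerBl ?(ltW T0)// => /(_ isT) GT Gt.
have /Hd : A (p + t *: - p) by exact: At.
have -> : p + t *: - p - p = t *: - p by rewrite addrC addKr.
rewrite normrZ gtr0_norm// normrN => /(_ (lt_trans _ Td)).
rewrite ltr_pM2r// => /(_ tT) Hg.
have : kappa * (((1 - T) * r)^-1 - r^-1) = kappa / r * T / (1 - T).
  by field; rewrite !gt_eqF.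
move: GT Gt; rewrite Gp dotNr => GT Gt E; rewrite E in GT.
have h1 : kappa / r * T <= kappa / r * T / (1 - T).
  rewrite ler_pdivlMr// ler_piMr ?gerBl ?(ltW T0)//.
  by rewrite mulr_ge0 ?(ltW T0)// divr_ge0// ltW.
have h2 : - (kappa / r) * T < dot (grad G (p + t *: - p)) p * T by rewrite ltr_pM2r.
lra.
Qed.

Lemma grad_upper q : equipotential K' G c q -> enorm q = Rm -> C <= kappa / Rm ^+ 2.
Proof.
move=> lq qR; have [K'q Gq] := lq; have /KP[Kq /eqP q0] := K'q.
have [v gv vC] := gradC lq.
rewrite leNgt; apply/negP => CR.
have kR : 0 < kappa / Rm ^+ 2 by rewrite divr_gt0// exprn_gt0.
have C0 : 0 < C by exact: lt_trans CR.
have v0 : v != 0.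
  by apply: contraTneq C0 => v0; rewrite -vC v0 enorm0 ltxx.
(* The midpoint between the rate C kappa / Rm^2 allowed by the radial bound and the actual rate C^2
   of G along [v]. *)
pose m := C * (kappa / Rm ^+ 2 + C) / 2.
have m0 : 0 < m by rewrite divr_gt0// mulr_gt0// addr_gt0.
have mC : m < dot v v.
  rewrite -sqr_enorm vC /m expr2 -mulrA ltr_pM2l// ltr_pdivrMr//; lra.
have mk : C * (kappa / Rm ^+ 2) < m.
  by rewrite /m -mulrA ltr_pM2l// ltr_pdivlMr//; lra.
have [d1 d10 Hd1] := grad_limit_dot_gt gv mC.
have nq : 0 < `|q| by rewrite normr_gt0.
have nv : 0 < `|v| by rewrite normr_gt0.
(* The bound by |q| keeps all points considered away from the pole. *)
pose d := Num.min d1 `|q|; have d0 : 0 < d by rewrite lt_min d10.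
have Hd y : interior (~` Omega) y -> `|y - q| < d -> A y /\ m < dot (grad G y) v.
  rewrite lt_min => Iy /andP[yd yq]; have Ay : A y.
    by apply/AP; split => // y0; move: yq; rewrite y0 sub0r normrN ltxx.
  by split => //; exact: Hd1.
have [l0 l00 Hl] := radial_growth kappa0 C0 Rm0 mk.
pose l := Num.min (d / (4 * `|v|)) (l0 / 2).
have l_gt0 : 0 < l by rewrite lt_min !divr_gt0// mulr_gt0.
have ll0 : l < l0.
  by rewrite gt_min; apply/orP; right; rewrite ltr_pdivrMr// ltr_pMr// ltr1n.
have lv : l * `|v| <= d / 4.
  apply: (@le_trans _ _ (d / (4 * `|v|) * `|v|)).
    by rewrite ler_wpM2r// ge_min lexx.
  by rewrite le_eqVlt; apply/orP; left; apply/eqP; field; rewrite gt_eqF.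
(* Moving from a point of the interior near q in the direction of the limit
   gradient, G increases, so the boundary (where G vanishes) is not reached. *)
have move_up x : interior (~` Omega) x -> `|x - q| < d / 2 ->
    K' (x + l *: v) /\ G x + m * l <= G (x + l *: v).
  move=> Ix xq; have [T [T0 KT nKT HT]] := convex_body_exit bK Ix v0.
  have {nKT} GxT := G_bdry KT nKT.
  have near_q t : 0 <= t <= l -> `|x + t *: v - q| < d.
    move=> /andP[t0 tl]; rewrite addrAC (le_lt_trans (ler_normD _ _))//.
    have : `|t *: v| <= l * `|v| by rewrite normrZ ger0_norm// ler_wpM2r.
    lra.
  have K't t : 0 <= t <= l -> ~ Omega (x + t *: v) -> K' (x + t *: v).
    move=> /near_q tq Kt; apply/KP; split => // t0; move: tq.
    by rewrite t0 sub0r normrN ltNge ge_min lexx orbT.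
  have incr t : 0 < t <= l -> t <= T -> G x + m * t <= G (x + t *: v).
    move=> /andP[t0 tl] tT.
    have It s : 0 <= s < t -> interior (~` Omega) (x + s *: v).
      by move=> /andP[s0 st]; apply: HT; rewrite s0 (lt_le_trans st).
    have Kt : ~ Omega (x + t *: v).
      move: tT; rewrite le_eqVlt => /orP[/eqP->//|tT].
      by apply: intK; apply: HT; rewrite (ltW t0).
    have AI s : 0 < s < t -> A (x + s *: v) /\ m < dot (grad G (x + s *: v)) v.
      move=> /andP[s0 st]; apply: Hd; first by apply: It; rewrite (ltW s0).
      by apply: near_q; rewrite (ltW s0) (le_trans (ltW st)).
    have [||s /AI[_ ms] Gs] := @line_MVT R A G x v t oA G1 t0.
    - by move=> s /AI[].
    - apply: line_K'_continuous => s /andP[s0]; rewrite le_eqVlt => /orP[/eqP->|st].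
        by apply: K't => //; rewrite (ltW t0).
      apply: K't; first by rewrite s0 (le_trans (ltW st)).
      by apply: intK; apply: It; rewrite s0.
    by rewrite -lerBrDl Gs ler_wpM2r// ltW.
  have [Tl|lT] := leP T l; last first.
    split; last by apply: incr; rewrite ?l_gt0 ?lexx// ltW.
    apply: K't; first by rewrite lexx (ltW l_gt0).
    by apply: intK; apply: HT; rewrite (ltW l_gt0).
  have := incr T; rewrite T0 Tl lexx => /(_ isT isT).
  rewrite GxT => GT.
  have : 0 <= G x.
    apply: green_ge0; apply/KP; split; first exact: intK.
    move=> x0; have := near_q 0; rewrite lexx (ltW l_gt0) scale0r addr0 => /(_ isT).
    by rewrite x0 sub0r normrN ltNge ge_min lexx orbT.
  have : 0 < m * T by rewrite mulr_gt0.
  by lra.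
have [|eta0 /andP[eta00 eta_ml] Heta] := Hl l; first by rewrite l_gt0.
pose eta := eta0 / 2; have eta_gt0 : 0 < eta by rewrite divr_gt0.
have eta_lt : eta < eta0 by rewrite ltr_pdivrMr// ltr_pMr// ltr1n.
have [d2 d20 Hd2] : exists2 d2 : R, 0 < d2 &
    forall y, K' y -> `|y - q| < d2 -> `|c - G y| < eta.
  apply/within_normP; rewrite -Gq.
  move/subspace_continuousP: cG => /(_ _ K'q) cq.
  exact: (cvgr_dist_lt _ _ cq _ eta_gt0).
have eq0 : 0 < enorm q by rewrite enorm_gt0.
(* The path starts at the interior point x = (1 - s) q, since [q] itself may lie on the boundary.
   [s] is so small that G x differs from [c] by less than [eta] and that the shift costs at most
   [eta] in distance. *)
pose s := Num.min 2^-1 (Num.min (d / (4 * `|q|)) (Num.min (d2 / (2 * `|q|)) (eta / Rm))).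
have s0 : 0 < s by rewrite !lt_min invr_gt0 ltr0n/= !divr_gt0// mulr_gt0.
have s1 : s < 1 by rewrite gt_min; apply/orP; left; rewrite invf_lt1// ltr1n.
have sq1 : s * `|q| < d / 2.
  apply: (@le_lt_trans _ _ (d / (4 * `|q|) * `|q|)).
    by rewrite ler_wpM2r// !ge_min lexx !orbT.
  have -> : d / (4 * `|q|) * `|q| = d / 4 by field; rewrite gt_eqF.
  lra.
have sq2 : s * `|q| < d2.
  apply: (@le_lt_trans _ _ (d2 / (2 * `|q|) * `|q|)).
    by rewrite ler_wpM2r// !ge_min lexx !orbT.
  have -> : d2 / (2 * `|q|) * `|q| = d2 / 2 by field; rewrite gt_eqF.
  lra.
have sR : s * Rm <= eta.
  by rewrite -ler_pdivlMr// !ge_min lexx !orbT.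
pose x := (1 - s) *: q.
have xq : x - q = - (s *: q) by rewrite /x scalerBl scale1r addrAC subrr add0r.
have Ix : interior (~` Omega) x.
  by apply: segI => //; rewrite subr_ge0 (ltW s1) gtrBl.
have nxq : `|x - q| = s * `|q| by rewrite xq normrN normrZ gtr0_norm.
have K'x : K' x.
  apply/KP; split; first exact: intK.
  by apply/eqP; rewrite scaler_eq0 negb_or q0 andbT gt_eqF// subr_gt0.
have [K'y Gy] : K' (x + l *: v) /\ G x + m * l <= G (x + l *: v).
  by apply: move_up => //; rewrite nxq.
have : `|c - G x| < eta by apply: Hd2 => //; rewrite nxq.
rewrite ltr_norml => /andP[_ Gx].
have cy : c < G (x + l *: v) by lra.
have GY := green_le_radial K'y cy.
have ey : Rm - l * C - eta <= enorm (x + l *: v).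
  have := enorm_triangle q (x + l *: v) 0; rewrite !subr0 qR.
  have := enormD (s *: q) (- (l *: v)).
  have -> : s *: q - l *: v = q - (x + l *: v).
    by rewrite opprD addrA; congr (_ - _); rewrite -[q - x]opprB xq opprK.
  rewrite enormN !enormZ !gtr0_norm// qR vC; lra.
have Y0 : 0 < enorm (x + l *: v) by have /KP[_ /eqP/enorm_gt0] := K'y.
have := Heta eta _ _ Y0 ey; rewrite eta_gt0 eta_lt => /(_ isT); lra.
Qed.

End extremal_radii.

Lemma interior_constant_gradient_level :
  exists rho : R, 0 < rho /\ bdry Omega = sphere 0 rho.
Proof.
have [p /set_mem lp pmin] := compact_EVT_min lev0 level_compact level_continuous.
have [q /set_mem lq qmax] := compact_EVT_max lev0 level_compact level_continuous.
have lev_ge x : equipotential K' G c x -> enorm p <= enorm x.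
  by move=> lx; have := pmin x (mem_set lx); rewrite !subr0.
have lev_le x : equipotential K' G c x -> enorm x <= enorm q.
  by move=> lx; have := qmax x (mem_set lx); rewrite !subr0.
have r0 : 0 < enorm p by have [/KP[_ /eqP p0] _] := lp; exact: enorm_gt0.
have R0 : 0 < enorm q by exact: lt_le_trans (lev_ge _ lq).
have qp : enorm q = enorm p.
  have := le_trans (grad_lower r0 lev_ge lp erefl) (grad_upper lev_le R0 lq erefl).
  rewrite ler_pM2l// lef_pV2 ?posrE ?exprn_gt0// ler_pXn2r ?nnegrE ?(ltW r0) ?(ltW R0)// => pq.
  by apply/eqP; rewrite eq_le pq lev_ge.
(* With equal radii the lower and the upper radial bound coincide, so [w] vanishes on the punctured
   ball. *)
pose w x := G x - (kappa * (enorm (x - 0))^-1 + (c - kappa / enorm p)).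
have w0 x : x <> 0 -> enorm x < enorm p -> w x = 0.
  move=> x0 xp; have Ax := inner_ball_interior lev_ge x0 xp.
  have h1 := green_ge_radial r0 lev_ge x0 (ltW xp).
  have h2 := green_le_radial lev_le R0 (AK Ax) (inner_ball_gt lev_ge x0 xp).
  by rewrite qp in h2; rewrite /w subr0; lra.
have hw x : A x -> harmonic_at w x.
  move=> Ax; have /AP[_ x0] := Ax; apply: harmonic_atB; first exact: hG.
  by apply: harmonic_atD; [exact: harmonic_inv | exact: harmonic_at_cst].
(* The segment from [s *: x] to [t *: x] avoids the pole, stays in the interior by convexity and
   starts in the ball where [w] vanishes. *)
have wray x (t : R) : bdry Omega x -> 0 < t < 1 -> w (t *: x) = 0.
  rewrite bdry_openE// => -[Kx nIx] /andP[t0 t1].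
  have x0 : x != 0 by apply/eqP => x0; apply: nIx; rewrite x0.
  have ex := enorm_gt0 x0.
  pose s := Num.min t (enorm p / (2 * enorm x)).
  have s0 : 0 < s by rewrite lt_min t0 divr_gt0// mulr_gt0.
  have st : s <= t by rewrite ge_min lexx.
  have sp : enorm (s *: x) < enorm p.
    rewrite enormZ gtr0_norm//.
    apply: (@le_lt_trans _ _ (enorm p / (2 * enorm x) * enorm x)).
      by rewrite ler_wpM2r ?(ltW ex)// ge_min lexx orbT.
    have -> : enorm p / (2 * enorm x) * enorm x = enorm p / 2 by field; rewrite gt_eqF.
    lra.
  have tx0 (u : R) : 0 < u -> u *: x <> 0.
    by move=> u0; apply/eqP; rewrite scaler_eq0 negb_or x0 gt_eqF.
  apply: (@unique_continuation R A [set s *: x + u *: x | u in `[0, t - s]] w (s *: x) oA hw).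
  - exact: connected_segment.
  - move=> y [u /=]; rewrite in_itv/= => /andP[u0 ut] <-; rewrite -scalerDl.
    apply/AP; split; first by apply: segI => //; lra.
    by apply: tx0; lra.
  - by exists 0; rewrite ?scale0r ?addr0//= in_itv/= lexx subr_ge0.
  - have [d d0 Hd] : exists2 d : R, 0 < d &
        forall y, `|y - s *: x| < d -> A y /\ enorm y < enorm p.
      apply/near_normP; apply: filterI.
        apply: open_nbhs_nbhs; split => //.
        exact: (inner_ball_interior lev_ge (tx0 _ s0) sp).
      have := (@enorm_continuous R 0 (s *: x)) _ (_ : nbhs (enorm (s *: x - 0)) [set z | z < enorm p]).
      rewrite /= => H; have : \forall y \near s *: x, enorm (y - 0) < enorm p.
        by apply: H; apply: open_nbhs_nbhs; split; [exact: open_lt | rewrite /= subr0].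
      by apply: filterS => y; rewrite subr0.
    apply/near_normP; exists d => // y /Hd[/AP[_ y0]]; exact: w0.
  - by exists (t - s); rewrite /= ?in_itv/= ?lexx ?subr_ge0 ?st// -scalerDl addrC subrK.
have wb x : bdry Omega x -> w x = 0.
  move=> bx; have [Kx nIx] : (~` Omega `\` interior (~` Omega)) x by rewrite -bdry_openE.
  have x0 : x != 0 by apply/eqP => x0; apply: nIx; rewrite x0.
  have K'x : K' x by apply/KP; split => //; exact/eqP.
  have cw : {within K', continuous w}.
    apply: (within_continuousB cG).
    apply/subspace_continuousP => y K'y; apply: cvgD; last exact: cvg_cst.
    by move/subspace_continuousP: (@cvg_inv_enorm kappa); exact.
  apply/eqP; rewrite -normr_le0 leNgt; apply/negP => wx.
  have [d d0 Hd] : exists2 d : R, 0 < d &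
      forall y, K' y -> `|y - x| < d -> `|w x - w y| < `|w x|.
    apply/within_normP; move/subspace_continuousP: cw => /(_ _ K'x) cwx.
    exact: (cvgr_dist_lt _ _ cwx _ wx).
  have nx : 0 < `|x| by rewrite normr_gt0.
  pose s := Num.min 2^-1 (d / (2 * `|x|)).
  have s0 : 0 < s by rewrite lt_min invr_gt0 ltr0n/= divr_gt0// mulr_gt0.
  have s1 : s < 1 by rewrite gt_min; apply/orP; left; rewrite invf_lt1// ltr1n.
  have K's : K' ((1 - s) *: x).
    apply/KP; split; first by apply: segK => //; rewrite subr_ge0 (ltW s1)/= gerBl ltW.
    by apply/eqP; rewrite scaler_eq0 negb_or x0 andbT gt_eqF// subr_gt0.
  have sd : `|(1 - s) *: x - x| < d.
    rewrite scalerBl scale1r addrAC subrr add0r normrN normrZ gtr0_norm//.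
    apply: (@le_lt_trans _ _ (d / (2 * `|x|) * `|x|)).
      by rewrite ler_wpM2r// ge_min lexx orbT.
    have -> : d / (2 * `|x|) * `|x| = d / 2 by field; rewrite gt_eqF.
    lra.
  have := Hd _ K's sd; rewrite wray ?subr0 ?ltxx//.
  by rewrite subr_gt0 s1 gtrBl.
(* At the boundary G = 0, so w = 0 there fixes the value of 1 / |x|. *)
have inv_b x : bdry Omega x -> (enorm x)^-1 = (enorm p)^-1 - c / kappa.
  move=> bx; have := wb _ bx; rewrite /w G0// subr0 => E.
  apply: (mulfI (lt0r_neq0 kappa0)).
  by rewrite mulrBr [kappa * (c / kappa)]mulrC divfK ?gt_eqF//; lra.
have [b bb] := bdry_nonempty oO bK.
have b0 : 0 < enorm b.
  apply: enorm_gt0; apply/eqP => b0; move: bb; rewrite bdry_openE// b0 => -[_]; exact.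
exists (enorm b); split => //; apply: bdry_eq_sphere => // x bx.
by rewrite subr0; apply: invr_inj; rewrite (inv_b _ bx) (inv_b _ bb).
Qed.

End interior_problem.

(** Supplies the two-sided bound near the pole with kappa = 1 / (4 pi), in terms of the Euclidean
    norm although neighbourhoods are given by the sup norm. *)
Lemma pole_asymptotics (R : realType) (G : 'rV[R]_3 -> R) :
  G r / (1 / (4 * pi * enorm r)) @[r --> (0 : 'rV[R]_3)^'] --> (1 : R) ->
  forall e : R, 0 < e -> exists2 d : R, 0 < d & forall x, x != 0 -> enorm x < d ->
    (1 - e) * (4 * pi)^-1 / enorm x <= G x <= (1 + e) * (4 * pi)^-1 / enorm x.
Proof.
move=> sing e e0.
have [d d0 Hd] : exists2 d : R, 0 < d & forall x : 'rV[R]_3, x != 0 -> `|x - 0| < d ->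
    `|1 - G x / (1 / (4 * pi * enorm x))| < e.
  by apply/within_normP; exact: (cvgr_dist_lt _ _ sing _ e0).
exists d => // x x0 xd; have ex := enorm_gt0 x0.
have := Hd x x0; rewrite subr0 => /(_ (le_lt_trans (norm_le_enorm _) xd)).
have := pi_gt0 R; move: (@pi R) => P p0.
have -> : G x / (1 / (4 * P * enorm x)) = G x * (4 * P * enorm x).
  by field; rewrite !gt_eqF.
have E k : k * (4 * P)^-1 / enorm x = k / (4 * P * enorm x) by rewrite -mulrA -invfM.
have Px : 0 < 4 * P * enorm x by rewrite !mulr_gt0.
rewrite !E ltr_norml ler_pdivrMr// ler_pdivlMr// => /andP[h1 h2].
by apply/andP; split; lra.
Qed.

Theorem corollary1p2 (R : realType) (Omega : set 'rV[R]_3)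
    (hOmega : convex_exterior_domain Omega) :
  (forall (n : 'rV[R]_3 -> 'rV[R]_3) (U : 'rV[R]_3 -> R) (Phi : R),
     exterior_dirichlet Omega n U Phi ->
     (exists (c : R) (a : 'rV[R]_3) (rho : R), 0 < rho /\
        equipotential (closure Omega) U c = sphere a rho) ->
     exists (a : 'rV[R]_3) (rho : R), 0 < rho /\ bdry Omega = sphere a rho)
  /\
  (forall G : 'rV[R]_3 -> R,
     interior_green Omega G ->
     (exists c : R,
        equipotential (~` (Omega `|` [set 0])) G c !=set0 /\
        constant_grad_norm (~` (closure Omega `|` [set 0])) G
          (equipotential (~` (Omega `|` [set 0])) G c)) ->
     exists rho : R, 0 < rho /\ bdry Omega = sphere 0 rho).

Proof.
have [[oO _] _ _ _ bK] := hOmega.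
split=> [n U Phi extU [c [a [rho [rho0 lev]]]]|G intG [c [lev0 [C gradC]]]].
  have [_ cU _] := extU_smooth extU.
  have [k Uk] := extU_bdry extU.
  have [kappa _ [M M0 UM]] := exterior_asymptotics (extU_flux_gt0 extU) (extU_infty extU).
  apply: (exterior_sphere_level oO bK _ cU Uk M0 UM rho0 lev).
  by move=> x; apply: harmonic_on_at => //; exact: extU_harmonic extU.
have kappa0 : 0 < (4 * pi : R)^-1 by rewrite invr_gt0 mulr_gt0// pi_gt0.
have [CkG _] := intG_harmonic intG.
have G1 : Ck_on 1 (~` (closure Omega `|` [set 0])) G.
  move=> x Ax; split=> [s s1|s i s1]; first exact: ((CkG x Ax).1 s (leq_trans s1 _)).
  exact: ((CkG x Ax).2 s i (leq_trans s1 _)).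
apply: (@interior_constant_gradient_level R Omega G (4 * pi)^-1 c C oO bK
  (intG_pole intG) _ G1 (intG_continuous intG) (intG_bdry intG) kappa0
  (pole_asymptotics (intG_singularity intG)) lev0 gradC).
move=> x; apply: harmonic_on_at; last exact: intG_harmonic intG.
apply: closed_openC; apply: closedU; first exact: closed_closure.
by apply: accessible_closed_set1; apply: hausdorff_accessible; exact: norm_hausdorff.
Qed.
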